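(* Assume the linear-quadratic optimal control problem $\mathcal{P}([0,T];x_0)$ described in the context satisfies the boundedness, uniform complete controllability and coercivity assumptions (A1)--(A3) listed there, and let $(x^*,u^*,\lambda^* )$ be its unique optimal state, control and adjoint. Let $(x^{(k)},u^{(k)},\lambda^{(k)})_{k\ge 0}$ be the iterates of the overlapping Schwarz decomposition described in the context, with overlap parameters $\tau_j^0,\tau_j^1>0$ and $\tau:=\min_{1\le j\le m}\min\{\tau_j^0,\tau_j^1\}$. For $k\ge 0$ define $$\omega^{(k)}=\max\{\|x^{(k)}-x^*\|_\infty,\ \|u^{(k)}-u^*\|_\infty,\ \|\lambda^{(k)}-\lambda^*\|_\infty\}.$$ Then the Schwarz iteration exhibits the linear convergence $$\omega^{(k+1)}\le 3\,c(\sigma)\,e^{-\rho_Z(\sigma)\tau}\cdot\omega^{(k)},\qquad k\ge 0,$$ where $\rho_Z(\sigma)$ and $c(\sigma)$ are the explicit constants given in the context.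
   Context: Norms: $\|\cdot\|$ is the Euclidean norm of vectors and the operator norm of matrices; $\|f\|_\infty=\sup_{t\in[0,T]}\|f(t)\|$. For symmetric matrices, $\preceq$ is the Loewner order. $\Phi_M(t,s)$ denotes the evolution (state-transition) operator of $\dot x(t)=M(t)x(t)$, so $x(t)=\Phi_M(t,s)x(s)$. The controllability Gramian of $(A,B)$ is $W_{A,B}(t_0,t_1)=\int_{t_0}^{t_1}\Phi_A(t_0,s)B(s)B^\top(s)\Phi_A^\top(t_0,s)\,ds$. Problem $\mathcal{P}([0,T];x_0)$: minimize over $(u,x)$ $$\frac12\int_0^T\begin{bmatrix}x(t)\\ u(t)\end{bmatrix}^\top\begin{bmatrix}Q(t)&H^\top(t)\\ H(t)&R(t)\end{bmatrix}\begin{bmatrix}x(t)\\ u(t)\end{bmatrix}dt+\frac12x(T)^\top Q_Tx(T)$$ subject to $\dot x(t)=A(t)x(t)+B(t)u(t)$ on $(0,T]$, $x(0)=x_0$, with $x(t)\in\mathbb{R}^{n_x}$, $u(t)\in\mathbb{R}^{n_u}$, and $Q(t),R(t),Q_T$ symmetric. The adjoint associated with the optimal pair is the solution of $\dot\lambda^*=-A^\top\lambda^*-Qx^*-H^\top u^*$, $\lambda^*(T)=Q_Tx^*(T)$. Assumptions. (A1) $A,B,Q,H,R$ are continuous on $[0,T]$ with $\|A\|_\infty\le\lambda_A$, $\|B\|_\infty\le\lambda_B$, $\|Q\|_\infty\le\lambda_Q$, $\|H\|_\infty\le\lambda_H$, $\|R\|_\infty\le\lambda_R$, for positive constants independent of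 $T$. (A2) (Uniform complete controllability) There are a fixed $\sigma\in(0,T)$ and constants $\alpha_0,\alpha_1,\beta_0,\beta_1>0$ (possibly depending on $\sigma$) such that for every $t_0\in[0,T-\sigma]$ there is $t_1=t_1(t_0)\in[t_0,t_0+\sigma]$ with $\alpha_0I\preceq W_{A,B}(t_0,t_1)\preceq\alpha_1I$ and $\beta_0I\preceq\Phi_A(t_1,t_0)W_{A,B}(t_0,t_1)\Phi_A^\top(t_1,t_0)\preceq\beta_1I$. (A3) There are $\gamma_R,\gamma_Q>0$ independent of $T$ with $R(t)\succeq\gamma_RI$ and $Q(t)-H^\top(t)R^{-1}(t)H(t)\succeq\gamma_QI$ for all $t\in[0,T]$, and $\gamma_QI\preceq Q_T\preceq\lambda_QI$. Domain decomposition: $0=t_0<t_1<\dots<t_m=T$; overlap parameters $\tau_j^0,\tau_j^1>0$; $t_j^0=\max\{t_{j-1}-\tau_j^0,0\}$, $t_j^1=\min\{t_j+\tau_j^1,T\}$ for $j=1,\dots,m$. Subproblem $\mathcal{P}_j([t_j^0,t_j^1];p_j,q_j)$: minimize $$\frac12\int_{t_j^0}^{t_j^1}\begin{bmatrix}x_j\\ u_j\end{bmatrix}^\top\begin{bmatrix}Q&H^\top\\ H&R\end{bmatrix}\begin{bmatrix}x_j\\ u_j\end{bmatrix}dt+L_j(x_j(t_j^1);q_j)$$ subject to $\dot x_j=Ax_j+Bu_j$ on $(t_j^0,t_j^1]$, $x_j(t_j^0)=p_j$, where $L_j(x;q)=\frac12x^\top Q(t_j^1)x-x^\top Q(t_j^1)q$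 if $j<m$ and $L_m(x;q)=\frac12x^\top Q_Tx$. Its adjoint $\lambda_j$ solves $\dot\lambda_j=-A^\top\lambda_j-Qx_j-H^\top u_j$, $\lambda_j(t_j^1)=\nabla_xL_j(x_j(t_j^1);q_j)$. Schwarz iteration: start from any $(x^{(0)},u^{(0)},\lambda^{(0)}):[0,T]\to\mathbb{R}^{n_x}\times\mathbb{R}^{n_u}\times\mathbb{R}^{n_x}$ with $x^{(0)}(0)=x_0$. For $k\ge0$ and each $j$ let $p_j^{(k+1)}=x^{(k)}(t_j^0)$, $q_j^{(k+1)}=x^{(k)}(t_j^1)-Q^{-1}(t_j^1)\lambda^{(k)}(t_j^1)$, let $(x_j^{(k+1)},u_j^{(k+1)},\lambda_j^{(k+1)})$ be the (exact, unique) optimal state, control and adjoint of $\mathcal{P}_j([t_j^0,t_j^1];p_j^{(k+1)},q_j^{(k+1)})$, and set $(x^{(k+1)},u^{(k+1)},\lambda^{(k+1)})(t)=(x_j^{(k+1)},u_j^{(k+1)},\lambda_j^{(k+1)})(t)$ for $t\in[t_{j-1},t_j)$ if $j\le m-1$, and for $t\in[t_{m-1},t_m]$ if $j=m$. Constants: $\kappa=\lambda_A+\lambda_B\lambda_H/\gamma_R$; $\alpha_1'=\frac{\lambda_B^2(e^{2\kappa\sigma}-1)}{2\kappa}$; $\alpha_0'=\Big(\frac{2}{\alpha_0}+\frac{\lambda_H^2}{\gamma_R^2\lambda_A}\big(1+\frac{\alpha_1}{\alpha_0}\big)^2(e^{2\lambda_A\sigma}-1)\Big)^{-1}$; $\tilde\alpha_0=\frac{1-e^{-2\kappa\sigma}}{2\kappa}$;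 $\tilde\alpha_1=\frac{e^{2\kappa\sigma}-1}{2\kappa}$; $c_0(\sigma)=\min\Big\{2\kappa\Big(\frac{\lambda_B^2}{\gamma_R}\big(1+\frac{\tilde\alpha_1}{\tilde\alpha_0}\big)^2+\frac{1}{\gamma_Q\tilde\alpha_0^2}\Big)^{-1},\Big(\frac{\lambda_B^2}{2\gamma_R\kappa}+\frac1{\gamma_Q}\Big)^{-1}\Big\}e^{-2\kappa\sigma}$; $c_1(\sigma)=\max\Big\{\frac{1}{2\kappa}\Big(\big(\lambda_Q+\frac{\lambda_H^2}{\gamma_R}\big)\big(1+\frac{\alpha_1'}{\alpha_0'}\big)^2+\frac{\lambda_R\lambda_B^2}{(\alpha_0')^2}\Big),\big(\lambda_Q+\frac{\lambda_H^2}{\gamma_R}\big)\big(1+\frac1{2\kappa}\big)\Big\}e^{2\kappa\sigma}$; $c_Z(\sigma)=\sqrt{c_1(\sigma)/c_0(\sigma)}$; $\rho_Z(\sigma)=\frac{\gamma_Q}{2c_1(\sigma)}$; $\Lambda_b(\sigma)=\Big\{1+\frac{\lambda_H}{\gamma_R}+\big(1+\frac{\lambda_B}{\gamma_R}\big)(c_1(\sigma)+\lambda_Q)\Big\}\max\Big\{c_Z(\sigma),\frac{c_Z^2(\sigma)\lambda_B^2\lambda_Q}{2\rho_Z(\sigma)\gamma_R}\Big\}$; $c(\sigma)=\Lambda_b(\sigma)(1+1/\gamma_Q)$.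
   Formalization: Added assumption: τ is at most the actual right overlap t_j^1 − t_j for every j<m (i.e. τ ≤ T − t_{m−1}); without it, clipping t_j^1 at T makes the stated rate false for large overlap parameters. *)

(* Defs.v *)
(* Library: MathComp and MathComp-Analysis. *)
From HB Require Import structures.
From mathcomp Require Import all_boot all_order all_algebra.
From mathcomp Require Import all_classical all_reals all_analysis.

Set Implicit Arguments.
Unset Strict Implicit.
Unset Printing Implicit Defensive.
Import Order.TTheory GRing.Theory Num.Theory.
Import numFieldNormedType.Exports.

Local Open Scope classical_set_scope.
Local Open Scope ring_scope.

(** * Norms, order, integrals *)

(* The library norm on matrices is the largest absolute value of an entry; the
   Euclidean and operator norms are therefore defined here. *)
Definition enorm (R : realType) (n : nat) (v : 'cV[R]_n) : R :=
  Num.sqrt (\sum_(i < n) v i 0 ^+ 2).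

Definition opnorm (R : realType) (m n : nat) (M : 'M[R]_(m, n)) : R :=
  sup [set enorm (M *m v) | v in [set v : 'cV[R]_n | enorm v <= 1]].

(* Extended-real valued: +oo when f is unbounded on [0, T]. *)
Definition supnorm (R : realType) (V : Type) (N : V -> R) (T : R) (f : R -> V)
    : \bar R :=
  ereal_sup [set (N (f t))%:E | t in `[0, T]].

Definition loewner_le (R : realType) (n : nat) (M N : 'M[R]_n) : Prop :=
  forall v : 'cV[R]_n, 0 <= (v^T *m (N - M) *m v) 0 0.

Definition mxintegral (R : realType) (m n : nat) (a b : R)
    (F : R -> 'M[R]_(m, n)) : 'M[R]_(m, n) :=
  \matrix_(i, j) \int[lebesgue_measure]_(s in `[a, b]) F s i j.

Definition gradient (R : realType) (n : nat) (f : 'cV[R]_n -> R)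
    (x : 'cV[R]_n) : 'cV[R]_n :=
  \col_(i < n) 'D_(delta_mx i 0) f x.

(* Classical solution of y' = F on [a, b]. As F is continuous on [a, b] in all
   uses below, continuity of y on [a, b] also gives the one-sided derivatives
   of y at the two end points. *)
Definition solves_on (R : realType) (m n : nat) (a b : R)
    (y F : R -> 'M[R]_(m, n)) : Prop :=
  {within `[a, b], continuous y} /\
  (forall t : R, a < t < b -> is_derive t (1 : R) y (F t)).

(** * Linear-quadratic optimal control *)

Record lq_data (R : realType) (nx nu : nat) := LQData {
  mxA : R -> 'M[R]_nx;
  mxB : R -> 'M[R]_(nx, nu);
  mxQ : R -> 'M[R]_nx;
  mxH : R -> 'M[R]_(nu, nx);
  mxR : R -> 'M[R]_nu;
  mxQT : 'M[R]_nx }.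

Record lq_constants (R : realType) := LQConstants {
  lamA : R; lamB : R; lamQ : R; lamH : R; lamR : R;
  sigma : R; alpha0 : R; alpha1 : R; beta0 : R; beta1 : R;
  gamR : R; gamQ : R }.

Section Problem.
Context {R : realType} {nx nu : nat}.
Implicit Types (D : lq_data R nx nu) (C : lq_constants R) (T a b : R).

Definition stage_cost D (x : 'cV[R]_nx) (u : 'cV[R]_nu) (t : R) : R :=
  ((col_mx x u)^T
   *m block_mx (mxQ D t) (mxH D t)^T (mxH D t) (mxR D t)
   *m col_mx x u) 0 0.

Definition cost D a b (L : 'cV[R]_nx -> R)
    (x : R -> 'cV[R]_nx) (u : R -> 'cV[R]_nu) : R :=
  2^-1 * (\int[lebesgue_measure]_(t in `[a, b]) stage_cost D (x t) (u t) t)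
  + L (x b).

(* Controls are continuous, so that they are determined pointwise (and not only
   almost everywhere) by optimality. *)
Definition feasible D a b (p : 'cV[R]_nx)
    (x : R -> 'cV[R]_nx) (u : R -> 'cV[R]_nu) : Prop :=
  [/\ {within `[a, b], continuous u},
      solves_on a b x (fun t => mxA D t *m x t + mxB D t *m u t)
    & x a = p].

Definition optimal D a b (p : 'cV[R]_nx) (L : 'cV[R]_nx -> R)
    (x : R -> 'cV[R]_nx) (u : R -> 'cV[R]_nu) : Prop :=
  feasible D a b p x u /\
  (forall y v, feasible D a b p y v -> cost D a b L x u <= cost D a b L y v).

Definition adjoint D a b (x : R -> 'cV[R]_nx) (u : R -> 'cV[R]_nu)
    (lb : 'cV[R]_nx) (l : R -> 'cV[R]_nx) : Prop :=
  solves_on a b l (fun t => - ((mxA D t)^T *m l t) - mxQ D t *m x t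
                            - (mxH D t)^T *m u t) /\
  l b = lb.

Definition final_cost D (x : 'cV[R]_nx) : R :=
  2^-1 * (x^T *m mxQT D *m x) 0 0.

(** * Standing assumptions *)

Definition symmetric_data D T : Prop :=
  [/\ forall t, 0 <= t <= T -> (mxQ D t)^T = mxQ D t,
      forall t, 0 <= t <= T -> (mxR D t)^T = mxR D t
    & (mxQT D)^T = mxQT D].

Definition bounded_data D C T : Prop :=
  [/\ [/\ 0 < lamA C, 0 < lamB C, 0 < lamQ C, 0 < lamH C & 0 < lamR C],
      [/\ {within `[0, T], continuous (mxA D)},
          {within `[0, T], continuous (mxB D)},
          {within `[0, T], continuous (mxQ D)},
          {within `[0, T], continuous (mxH D)}
        & {within `[0, T], continuous (mxR D)}]
    & [/\ (supnorm (@opnorm R _ _) T (mxA D) <= (lamA C)%:E)%E,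
          (supnorm (@opnorm R _ _) T (mxB D) <= (lamB C)%:E)%E,
          (supnorm (@opnorm R _ _) T (mxQ D) <= (lamQ C)%:E)%E,
          (supnorm (@opnorm R _ _) T (mxH D) <= (lamH C)%:E)%E
        & (supnorm (@opnorm R _ _) T (mxR D) <= (lamR C)%:E)%E]].

(* [Phi t s] is the state-transition operator from time s to time t, for both
   orderings of s and t. *)
Definition evolution_operator (A : R -> 'M[R]_nx) T (Phi : R -> R -> 'M[R]_nx)
    : Prop :=
  forall s, 0 <= s <= T ->
    Phi s s = 1%:M /\
    solves_on 0 T (fun t => Phi t s) (fun t => A t *m Phi t s).

Definition gramian (Phi : R -> R -> 'M[R]_nx) (B : R -> 'M[R]_(nx, nu))
    (t0 t1 : R) : 'M[R]_nx :=
  mxintegral t0 t1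
    (fun s => Phi t0 s *m B s *m (B s)^T *m (Phi t0 s)^T).

Definition uniformly_completely_controllable D C T
    (Phi : R -> R -> 'M[R]_nx) : Prop :=
  [/\ 0 < sigma C < T,
      [/\ 0 < alpha0 C, 0 < alpha1 C, 0 < beta0 C & 0 < beta1 C]
    & forall t0, 0 <= t0 <= T - sigma C ->
      exists t1, let W := gramian Phi (mxB D) t0 t1 in
      [/\ t0 <= t1 <= t0 + sigma C,
          loewner_le (alpha0 C)%:M W, loewner_le W (alpha1 C)%:M,
          loewner_le (beta0 C)%:M (Phi t1 t0 *m W *m (Phi t1 t0)^T)
        & loewner_le (Phi t1 t0 *m W *m (Phi t1 t0)^T) (beta1 C)%:M]].

Definition coercive D C T : Prop :=
  [/\ 0 < gamR C, 0 < gamQ C,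
      forall t, 0 <= t <= T ->
        loewner_le (gamR C)%:M (mxR D t) /\
        loewner_le (gamQ C)%:M
          (mxQ D t - (mxH D t)^T *m invmx (mxR D t) *m mxH D t),
      loewner_le (gamQ C)%:M (mxQT D)
    & loewner_le (mxQT D) (lamQ C)%:M].

(** * Overlapping Schwarz decomposition *)

(* Subdomains are indexed by j = 1, ..., m; subdomain j is [t (j-1), t j] and
   its enlargement is [left_end t tau0 j, right_end t tau1 T j]. *)
Definition decomposition T (m : nat) (t tau0 tau1 : nat -> R) : Prop :=
  [/\ t 0%N = 0, t m = T, forall j, (j < m)%N -> t j < t j.+1
    & forall j, (1 <= j <= m)%N -> 0 < tau0 j /\ 0 < tau1 j].

Definition left_end (t tau0 : nat -> R) (j : nat) : R :=
  Num.max (t j.-1 - tau0 j) 0.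

Definition right_end (t tau1 : nat -> R) T (j : nat) : R :=
  Num.min (t j + tau1 j) T.

(* The starting value of the fold is the term j = 1, which belongs to the
   range whenever m > 0. *)
Definition overlap (m : nat) (tau0 tau1 : nat -> R) : R :=
  \big[Num.min/Num.min (tau0 1%N) (tau1 1%N)]_(1 <= j < m.+1)
    Num.min (tau0 j) (tau1 j).

(* [M] is the value of the state weight Q at the right end of the subdomain;
   it is used only for j < m. *)
Definition sub_final_cost D (m j : nat) (M : 'M[R]_nx) (q x : 'cV[R]_nx) : R :=
  if (j < m)%N then 2^-1 * (x^T *m M *m x) 0 0 - (x^T *m M *m q) 0 0
  else final_cost D x.

Definition sub_solution D (m j : nat) a b (p q : 'cV[R]_nx)
    (x : R -> 'cV[R]_nx) (u : R -> 'cV[R]_nu) (l : R -> 'cV[R]_nx) : Prop :=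
  let L := sub_final_cost D m j (mxQ D b) q in
  optimal D a b p L x u /\ adjoint D a b x u (gradient L (x b)) l.

Definition kept_part (m : nat) (t : nat -> R) (j : nat) : set R :=
  [set` if (j < m)%N then `[t j.-1, t j[ else `[t j.-1, t j]].

Definition schwarz_iterates D T (x0 : 'cV[R]_nx) (m : nat)
    (t tau0 tau1 : nat -> R)
    (x : nat -> R -> 'cV[R]_nx) (u : nat -> R -> 'cV[R]_nu)
    (l : nat -> R -> 'cV[R]_nx) : Prop :=
  x 0%N 0 = x0 /\
  forall k j : nat, (1 <= j <= m)%N ->
    let a := left_end t tau0 j in
    let b := right_end t tau1 T j in
    exists xj uj lj,
      sub_solution D m j a b
        (x k a) (x k b - invmx (mxQ D b) *m l k b) xj uj lj /\
      (forall s, kept_part m t j s ->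
        [/\ x k.+1 s = xj s, u k.+1 s = uj s & l k.+1 s = lj s]).

Definition error T
    (xs : R -> 'cV[R]_nx) (us : R -> 'cV[R]_nu) (ls : R -> 'cV[R]_nx)
    (x : R -> 'cV[R]_nx) (u : R -> 'cV[R]_nu) (l : R -> 'cV[R]_nx) : \bar R :=
  Order.max
    (Order.max (supnorm (@enorm R _) T (fun s => x s - xs s))
               (supnorm (@enorm R _) T (fun s => u s - us s)))
    (supnorm (@enorm R _) T (fun s => l s - ls s)).

End Problem.

(** * Explicit constants *)

Section Constants.
Context {R : realType}.
Implicit Types C : lq_constants R.

Definition kappa C : R := lamA C + lamB C * lamH C / gamR C.

Definition alpha1' C : R :=
  lamB C ^+ 2 * (expR (2 * kappa C * sigma C) - 1) / (2 * kappa C).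

Definition alpha0' C : R :=
  (2 / alpha0 C
   + lamH C ^+ 2 / (gamR C ^+ 2 * lamA C) * (1 + alpha1 C / alpha0 C) ^+ 2
     * (expR (2 * lamA C * sigma C) - 1))^-1.

Definition alpha0_tilde C : R :=
  (1 - expR (- (2 * kappa C * sigma C))) / (2 * kappa C).

Definition alpha1_tilde C : R :=
  (expR (2 * kappa C * sigma C) - 1) / (2 * kappa C).

Definition c0 C : R :=
  Num.min
    (2 * kappa C
     * (lamB C ^+ 2 / gamR C * (1 + alpha1_tilde C / alpha0_tilde C) ^+ 2
        + 1 / (gamQ C * alpha0_tilde C ^+ 2))^-1)
    (lamB C ^+ 2 / (2 * gamR C * kappa C) + 1 / gamQ C)^-1
  * expR (- (2 * kappa C * sigma C)).

Definition c1 C : R :=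
  Num.max
    (1 / (2 * kappa C)
     * ((lamQ C + lamH C ^+ 2 / gamR C) * (1 + alpha1' C / alpha0' C) ^+ 2
        + lamR C * lamB C ^+ 2 / alpha0' C ^+ 2))
    ((lamQ C + lamH C ^+ 2 / gamR C) * (1 + 1 / (2 * kappa C)))
  * expR (2 * kappa C * sigma C).

Definition cZ C : R := Num.sqrt (c1 C / c0 C).

Definition rhoZ C : R := gamQ C / (2 * c1 C).

Definition LambdaB C : R :=
  (1 + lamH C / gamR C + (1 + lamB C / gamR C) * (c1 C + lamQ C))
  * Num.max (cZ C)
      (cZ C ^+ 2 * lamB C ^+ 2 * lamQ C / (2 * rhoZ C * gamR C)).

Definition c_sigma C : R := LambdaB C * (1 + 1 / gamQ C).

End Constants.

(* Main.v *)
Require Import Defs.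
From HB Require Import structures.
From mathcomp Require Import all_boot all_order all_algebra.
From mathcomp Require Import all_classical all_reals all_analysis.
From mathcomp Require Import ring lra.

(* Eliminating the control through R u + H x + B^T l = 0, which the first
   variation in the direction of the residual itself yields, turns the state and
   adjoint into a solution of a Hamiltonian system x' = F x - G l,
   l' = - F^T l - Q' x, where F = A - B R^-1 H, G = B R^-1 B^T and
   Q' = Q - H^T R^-1 H. The error of a subdomain solution solves the same linear
   system with boundary data p = x(a) and d = l(b) - K x(b).
   When d = 0, the value V = x^T l decreases with V' <= - gamQ |x|^2 and satisfies
   c0 |x|^2 <= V <= c1 |x|^2, so x decays at the rate rhoZ. The lower bound holds
   because V - c0 |x|^2 is nonincreasing; the upper bound compares the solution
   with a trajectory steered to 0 by the Gramian, or left uncontrolled near the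
   right end point.
   When d <> 0, let (X, L) be the matrix solution with X(b) = 1, L(b) = K. The
   symplectic product X^T l - L^T x is constantly d, so l = L X^-1 x + X^-T d,
   and (X^-1 x)' = - X^-1 G X^-T d. Both factors X(t) X^-1(s) and X^-T are
   controlled by the decay for d = 0. *)

(** In Riccati terms, L X^-1 is the solution P of the Riccati equation with P(b) = K, X(t) X^-1(s)
    is the closed-loop evolution operator, and V = x^T P x when d = 0. Working with P directly would
    require global existence for a nonlinear equation. The Hamiltonian system is linear, so (X, L)
    exists on all of [a, b], and the invertibility of X comes from the decay itself: a kernel vector
    of X(t) gives a solution whose state is 0 at t, hence 0 at b, where X = 1. For the same reason
    the bound of P by c1 is stated in the polarised form 2 l^T y <= x^T l + c1 |y|^2, in which P
    does not occur. When d <> 0, the perturbation X^-T(t) d decays backwards from b, because X^-1(t)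
    = X(b) X^-1(t) decays forwards. Its effect on x is an integral of e^(-rho (t - s)) e^(-rho (b -
    s)) over s <= t, at most e^(-rho (b - t)) / (2 rho); hence the quotient by 2 rho in [LambdaB].
    So wrong data at a and at b are damped by their distances from t separately. In the iteration, d
    is Q(b) applied to the error of the transmitted vector x - Q^-1 l; this is the origin of the
    factor 1 + 1 / gamQ. *)

Set Implicit Arguments.
Unset Strict Implicit.
Unset Printing Implicit Defensive.
Import Order.TTheory GRing.Theory Num.Theory.
Import numFieldNormedType.Exports.
Local Open Scope classical_set_scope.
Local Open Scope ring_scope.

(** * Continuity and differentiation of matrix-valued functions *)

Section MatrixContinuity.
Context {R : realType}.

Lemma cvg_mx (T : Type) (F : set_system T) {FF : Filter F} m n
    (f : T -> 'M[R]_(m, n)) (l : 'M[R]_(m, n)) :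
  (forall i j, f t i j @[t --> F] --> l i j) -> f t @[t --> F] --> l.
Proof.
move=> fl; apply/cvgrPdist_le => e e0; near=> t.
rewrite /Num.Def.normr/= mx_normrE (bigmax_le _ (ltW e0))//= => i _.
rewrite !mxE; move: i; near: t; apply: filter_forall => /= i.
exact: ((cvgrPdist_le _ _).1 (fl i.1 i.2)).
Unshelve. all: by end_near. Qed.

Lemma cvg_coord (T : Type) (F : set_system T) {FF : Filter F} m n
    (f : T -> 'M[R]_(m, n)) (l : 'M[R]_(m, n)) i j :
  f t @[t --> F] --> l -> f t i j @[t --> F] --> l i j.
Proof. by move=> fl; apply: (cvg_comp _ _ fl (@coord_continuous R m n i j l)). Qed.

Lemma cvg_mulmx (T : Type) (F : set_system T) {FF : Filter F} m n p
    (f : T -> 'M[R]_(m, n)) (g : T -> 'M[R]_(n, p))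
    (l : 'M[R]_(m, n)) (k : 'M[R]_(n, p)) :
  f t @[t --> F] --> l -> g t @[t --> F] --> k ->
  (f t *m g t) @[t --> F] --> l *m k.
Proof.
move=> fl gk; apply: cvg_mx => i j; rewrite mxE.
under eq_cvg do rewrite mxE.
apply: (cvg_big (@add_continuous R)) => h _.
by apply: cvgM; apply: cvg_coord.
Qed.

Lemma cvg_trmx (T : Type) (F : set_system T) {FF : Filter F} m n
    (f : T -> 'M[R]_(m, n)) (l : 'M[R]_(m, n)) :
  f t @[t --> F] --> l -> (f t)^T @[t --> F] --> l^T.
Proof.
move=> fl; apply: cvg_mx => i j; rewrite mxE.
under eq_cvg do rewrite mxE.
exact: cvg_coord.
Qed.

Lemma cvg_det (T : Type) (F : set_system T) {FF : Filter F} n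
    (f : T -> 'M[R]_n) (l : 'M[R]_n) :
  f t @[t --> F] --> l -> \det (f t) @[t --> F] --> \det l.
Proof.
move=> fl; rewrite /determinant.
apply: (cvg_big (@add_continuous R)) => s _.
apply: cvgM; first exact: cvg_cst.
by apply: (cvg_big (@mul_continuous R)) => i _; apply: cvg_coord.
Qed.

(** Cramer's rule: the inverse is the adjugate divided by the determinant, both polynomial in the
    entries. Invertibility is asked for every [t] because [invmx] returns a singular matrix
    unchanged. *)
Lemma cvg_invmx (T : Type) (F : set_system T) {FF : Filter F} n
    (f : T -> 'M[R]_n) (l : 'M[R]_n) :
  l \in unitmx -> (forall t, f t \in unitmx) ->
  f t @[t --> F] --> l -> invmx (f t) @[t --> F] --> invmx l.
Proof.
move=> lu fu fl.
rewrite /invmx lu; under eq_cvg do rewrite fu.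
apply: cvgZ.
  by apply: cvgV; [rewrite -unitfE -unitmxE | apply: cvg_det].
apply: cvg_mx => i j; rewrite !mxE; under eq_cvg do rewrite !mxE.
rewrite /cofactor; apply: cvgM; first exact: cvg_cst.
apply: cvg_det; apply: cvg_mx => i' j'; rewrite !mxE; under eq_cvg do rewrite !mxE.
exact: cvg_coord.
Qed.

End MatrixContinuity.

(** * Continuity on a closed interval *)

Section C1.
Context {R : realType}.
Implicit Types (a b : R) (V : normedModType R).

(** Has the body of [solves_on], with values in any normed module, so that the dynamics in the
    definitions of [feasible] and [adjoint] are [C1on] statements by conversion. *)
Definition C1on V a b (f g : R -> V) : Prop :=
  {within `[a, b], continuous f} /\
  (forall t : R, a < t < b -> is_derive t (1 : R) f (g t)).

Lemma within_ext V a b (f g : R -> V) :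
  (forall t, a <= t <= b -> f t = g t) ->
  {within `[a, b], continuous f} -> {within `[a, b], continuous g}.
Proof.
move=> fg; apply: subspace_eq_continuous => t; rewrite inE/= in_itv/= => tab.
exact: fg.
Qed.

Lemma within_sub V a b a' b' (f : R -> V) : a <= a' -> b' <= b ->
  {within `[a, b], continuous f} -> {within `[a', b'], continuous f}.
Proof.
move=> aa bb; apply: continuous_subspaceW => t /=.
rewrite !in_itv/= => /andP[h1 h2].
by rewrite (le_trans aa h1) (le_trans h2 bb).
Qed.

Lemma within_mulmx a b m n p (f : R -> 'M[R]_(m, n)) (g : R -> 'M[R]_(n, p)) :
  {within `[a, b], continuous f} -> {within `[a, b], continuous g} ->
  {within `[a, b], continuous (fun t => f t *m g t)}.
Proof. by move=> cf cg t; apply: cvg_mulmx; [exact: cf|exact: cg]. Qed.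

Lemma within_tr a b m n (f : R -> 'M[R]_(m, n)) :
  {within `[a, b], continuous f} -> {within `[a, b], continuous (fun t => (f t)^T)}.
Proof. by move=> cf t; apply: cvg_trmx; exact: cf. Qed.

Lemma within_coord a b m n (f : R -> 'M[R]_(m, n)) i j :
  {within `[a, b], continuous f} -> {within `[a, b], continuous (fun t => f t i j)}.
Proof. by move=> cf t; apply: cvg_coord; exact: cf. Qed.

Lemma within_mx a b m n (f : R -> 'M[R]_(m, n)) :
  (forall i j, {within `[a, b], continuous (fun t => f t i j)}) ->
  {within `[a, b], continuous f}.
Proof. by move=> cf t; apply: cvg_mx => i j; exact: cf. Qed.

Lemma withinD V a b (f g : R -> V) :
  {within `[a, b], continuous f} -> {within `[a, b], continuous g} ->
  {within `[a, b], continuous (fun t => f t + g t)}.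
Proof. by move=> cf cg t; apply: cvgD; [exact: cf|exact: cg]. Qed.

Lemma withinN V a b (f : R -> V) :
  {within `[a, b], continuous f} -> {within `[a, b], continuous (fun t => - f t)}.
Proof. by move=> cf t; apply: cvgN; exact: cf. Qed.

Lemma withinB V a b (f g : R -> V) :
  {within `[a, b], continuous f} -> {within `[a, b], continuous g} ->
  {within `[a, b], continuous (fun t => f t - g t)}.
Proof. by move=> cf cg; apply: withinD => //; apply: withinN. Qed.

Lemma within_cst V a b (c : V) : {within `[a, b], continuous (fun=> c)}.
Proof. by move=> t; apply: cvg_cst. Qed.

Lemma within_invmx a b n (f : R -> 'M[R]_n) :
  (forall t, a <= t <= b -> f t \in unitmx) ->
  {within `[a, b], continuous f} -> {within `[a, b], continuous (fun t => invmx (f t))}.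
Proof.
move=> fu cf.
(* [cvg_invmx] wants invertibility everywhere, so [f] is replaced by the identity outside the
   interval. *)
pose g t := if a <= t <= b then f t else 1%:M.
have fg : forall t, a <= t <= b -> f t = g t by move=> t h; rewrite /g h.
have gu t : g t \in unitmx by rewrite /g; case: ifP => [/fu//|_]; exact: unitmx1.
apply: (@within_ext _ _ _ (fun t => invmx (g t))) => [t /fg -> //|].
have cg := within_ext fg cf.
by move=> t; apply: cvg_invmx => //; exact: cg.
Qed.

End C1.

Arguments within_coord {R a b m n f} i j _.

(** * Differentiation rules and integration of differential inequalities *)

Section C1Calculus.
Context {R : realType}.
Implicit Types (a b : R) (V : normedModType R).

Lemma C1on_sub V a b a' b' (f g : R -> V) : a <= a' -> b' <= b ->
  C1on a b f g -> C1on a' b' f g.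
Proof.
move=> aa bb [cf df]; split; first exact: within_sub cf.
by move=> t /andP[h1 h2]; apply: df; rewrite (le_lt_trans aa h1) (lt_le_trans h2 bb).
Qed.

Lemma C1on_eq V a b (f g h : R -> V) :
  (forall t, a < t < b -> g t = h t) -> C1on a b f g -> C1on a b f h.
Proof. by move=> gh [cf df]; split => // t tab; rewrite -gh//; exact: df. Qed.

Lemma C1on_ext V a b (f h g : R -> V) :
  (forall t, a <= t <= b -> f t = h t) -> C1on a b f g -> C1on a b h g.
Proof.
move=> fh [cf df]; split; first exact: within_ext cf.
move=> t /andP[at1 tb].
have := df t; rewrite at1 tb => /(_ isT) dft.
apply: (@near_eq_is_derive _ _ _ f h) => //.
near=> s; apply: fh; apply/andP; split; apply: ltW; near: s.
- exact: lt_nbhsr.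
- exact: lt_nbhsl.
Unshelve. all: by end_near. Qed.

Lemma C1onD V a b (f g f' g' : R -> V) : C1on a b f f' -> C1on a b g g' ->
  C1on a b (fun t => f t + g t) (fun t => f' t + g' t).
Proof.
move=> [cf df] [cg dg]; split; first exact: withinD.
move=> t tab; have := df t tab; have := dg t tab => *; exact: is_deriveD.
Qed.

Lemma C1onN V a b (f f' : R -> V) : C1on a b f f' ->
  C1on a b (fun t => - f t) (fun t => - f' t).
Proof.
move=> [cf df]; split; first exact: withinN.
move=> t tab; have := df t tab => *; exact: is_deriveN.
Qed.

Lemma C1onB V a b (f g f' g' : R -> V) : C1on a b f f' -> C1on a b g g' ->
  C1on a b (fun t => f t - g t) (fun t => f' t - g' t).
Proof. by move=> hf hg; apply: C1onD => //; apply: C1onN. Qed.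

Lemma C1on_cst V a b (c : V) : C1on a b (fun=> c) (fun=> 0).
Proof.
split; first exact: within_cst.
by move=> t _; apply: is_derive_cst.
Qed.

Lemma C1onM a b (f g f' g' : R -> R) : C1on a b f f' -> C1on a b g g' ->
  C1on a b (fun t => f t * g t) (fun t => f' t * g t + f t * g' t).
Proof.
move=> [cf df] [cg dg]; split.
  by move=> t; apply: cvgM; [exact: cf|exact: cg].
move=> t tab; have := df t tab; have := dg t tab => Dg Df.
have := is_deriveM Df Dg => D; apply: (is_derive_eq D).
by rewrite addrC /GRing.scale/= mulrC.
Qed.

Lemma C1on_coord a b m n (f f' : R -> 'M[R]_(m, n)) i j : C1on a b f f' ->
  C1on a b (fun t => f t i j) (fun t => f' t i j).
Proof.
move=> [cf df]; split; first exact: within_coord.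
move=> t tab; have [Df e] := df t tab.
split; first exact: (derivable_mxP f t 1).1.
by rewrite -e derive_mx// mxE.
Qed.

Lemma C1on_mx a b m n (f f' : R -> 'M[R]_(m, n)) :
  (forall i j, C1on a b (fun t => f t i j) (fun t => f' t i j)) -> C1on a b f f'.
Proof.
move=> h; split; first by apply: within_mx => i j; exact: (h i j).1.
move=> t tab.
have Df : derivable f t 1.
  by apply/derivable_mxP => i j; case: ((h i j).2 t tab).
split => //; rewrite derive_mx//; apply/matrixP => i j; rewrite mxE.
by case: ((h i j).2 t tab).
Qed.

Lemma C1on_sum a b n (f f' : 'I_n -> R -> R) :
  (forall i, C1on a b (f i) (f' i)) ->
  C1on a b (fun t => \sum_i f i t) (fun t => \sum_i f' i t).
Proof.
move=> h; split.
  move=> t; apply: (cvg_big (@add_continuous R)) => i _; exact: (h i).1.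
move=> t tab.
have := @is_derive_sum R R R n f t 1 (fun i => f' i t) (fun i => (h i).2 t tab).
by rewrite fct_sumE.
Qed.

Lemma C1on_mulmx a b m n p (f f' : R -> 'M[R]_(m, n)) (g g' : R -> 'M[R]_(n, p)) :
  C1on a b f f' -> C1on a b g g' ->
  C1on a b (fun t => f t *m g t) (fun t => f' t *m g t + f t *m g' t).
Proof.
move=> hf hg; apply: C1on_mx => i j.
apply: (@C1on_ext _ _ _ (fun t => \sum_k f t i k * g t k j)).
  by move=> t _; rewrite mxE.
apply: (@C1on_eq _ _ _ _ (fun t => \sum_k (f' t i k * g t k j + f t i k * g' t k j))).
  by move=> t _; rewrite !mxE big_split.
by apply: C1on_sum => k; apply: C1onM; apply: C1on_coord.
Qed.

Lemma C1on_mulmxl a b m n p (c : 'M[R]_(m, n)) (g g' : R -> 'M[R]_(n, p)) :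
  C1on a b g g' -> C1on a b (fun t => c *m g t) (fun t => c *m g' t).
Proof.
move=> hg; apply: C1on_eq (C1on_mulmx (C1on_cst a b c) hg) => t _ /=.
by rewrite mul0mx add0r.
Qed.

Lemma C1on_mulmxr a b m n p (c : 'M[R]_(n, p)) (g g' : R -> 'M[R]_(m, n)) :
  C1on a b g g' -> C1on a b (fun t => g t *m c) (fun t => g' t *m c).
Proof.
move=> hg; apply: C1on_eq (C1on_mulmx hg (C1on_cst a b c)) => t _ /=.
by rewrite mulmx0 addr0.
Qed.

Lemma C1onZ a b (c : R) (f f' : R -> R) : C1on a b f f' ->
  C1on a b (fun t => c * f t) (fun t => c * f' t).
Proof.
move=> h; apply: C1on_eq (C1onM (C1on_cst a b c) h) => t _ /=.
by rewrite mul0r add0r.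
Qed.

Lemma C1on_tr a b m n (f f' : R -> 'M[R]_(m, n)) :
  C1on a b f f' -> C1on a b (fun t => (f t)^T) (fun t => (f' t)^T).
Proof.
move=> h; apply: C1on_mx => i j.
apply: (@C1on_ext _ _ _ (fun t => f t j i)) => [t _|]; first by rewrite mxE.
apply: (@C1on_eq _ _ _ _ (fun t => f' t j i)) => [t _|]; first by rewrite mxE.
exact: C1on_coord.
Qed.

Lemma C1on_expR a b (k c : R) :
  C1on a b (fun t => expR (k * (t - c))) (fun t => k * expR (k * (t - c))).
Proof.
have d (t : R) : is_derive t (1 : R) (fun t => expR (k * (t - c)))
    (k * expR (k * (t - c))).
  have h : is_derive t (1 : R) (fun t => k * (t - c)) k.
    have -> : (fun t => k * (t - c)) = k \*: (id - cst c).
      by apply/funext.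
    by apply: is_derive_eq; rewrite subr0 /GRing.scale/= mulr1.
  have D := @is_derive1_comp _ expR (fun t => k * (t - c)) t _ _ (is_derive_expR _) h.
  apply: (is_derive_eq D).
  by rewrite mulrC.
split; last by move=> t _.
apply: continuous_subspaceT => t.
by apply/differentiable_continuous/derivable1_diffP; case: (d t).
Qed.

(** The form in which differential inequalities are integrated below: [f - g] is nonincreasing, and
    no integrability has to be checked. *)
Lemma C1on_le a b (f f' g g' : R -> R) : a <= b ->
  C1on a b f f' -> C1on a b g g' ->
  (forall t, a < t < b -> f' t <= g' t) -> f b - f a <= g b - g a.
Proof.
move=> ab hf hg le.
have [cd dd] := C1onB hf hg.
have mono : (fun t => f t - g t) b <= (fun t => f t - g t) a.
  apply: (@ler0_derive1_nincr _ (fun t => f t - g t) a b) => //.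
  - by move=> t; rewrite in_itv/= => /dd[].
  - move=> t; rewrite in_itv/= => h; rewrite derive1E.
    by have [_ ->] := dd _ h; rewrite subr_le0 le.
by move: mono => /=; lra.
Qed.

Lemma C1on_const a b m n (f : R -> 'M[R]_(m, n)) :
  C1on a b f (fun=> 0) -> forall s t, a <= s <= b -> a <= t <= b -> f s = f t.
Proof.
move=> h.
have main s t : a <= s -> s <= t -> t <= b -> f s = f t.
  move=> as1 st tb; apply/matrixP => i j.
  have h' := C1on_coord i j (C1on_sub as1 tb h).
  have h0 := C1on_cst s t (0 : R).
  have le0 : forall r, s < r < t -> (0 : 'M[R]_(m, n)) i j <= (0 : R) by move=> r _; rewrite mxE.
  have ge0 : forall r, s < r < t -> (0 : R) <= (0 : 'M[R]_(m, n)) i j by move=> r _; rewrite mxE.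
  have := C1on_le st h' h0 le0.
  have := C1on_le st h0 h' ge0.
  lra.
move=> s t /andP[h1 h2] /andP[h3 h4].
by have [st|/ltW ts] := leP s t; [exact: main|apply/esym/main].
Qed.

End C1Calculus.

(** * Antiderivatives and linear differential equations *)

Section Antiderivative.
Context {R : realType}.
Implicit Types (a b : R).

Lemma C1on_Rintegral a b (f : R -> R) : a <= b ->
  {within `[a, b], continuous f} ->
  C1on a b (fun t => \int[lebesgue_measure]_(s in `[a, t]) f s)%R f.
Proof.
move=> ab cf.
have intf : lebesgue_measure.-integrable `[a, b] (EFin \o f).
  by apply: continuous_compact_integrable => //; exact: segment_compact.
split; first exact: parameterized_integral_continuous.
move=> t /andP[at1 tb].
have ab' := lt_trans at1 tb.
have ct : {for t, continuous f}.
  have [h _ _] := (continuous_within_itvP f ab').1 cf.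
  by apply: h; rewrite in_itv/= at1.
have [D e] := continuous_FTC1_closed tb intf at1 ct.
split; first exact: D.
by rewrite -derive1E; exact: e.
Qed.

(** [f] and the integral of [g] have the same derivative in the interior; two applications of
    [C1on_le] compare their increments. *)
Lemma C1on_FTC a b (f g : R -> R) : a < b -> C1on a b f g ->
  {within `[a, b], continuous g} ->
  (\int[lebesgue_measure]_(s in `[a, b]) g s)%R = f b - f a.
Proof.
move=> ab hf cg.
have hg := C1on_Rintegral (ltW ab) cg.
have e (r s : R -> R) : C1on a b r g -> C1on a b s g -> r b - r a <= s b - s a.
  by move=> hr hs; apply: (C1on_le (ltW ab) hr hs).
have := e _ _ hf hg; have := e _ _ hg hf.
rewrite set_itv1 Rintegral_set1; lra.
Qed.

Lemma C1on_mxintegral m n a b (f : R -> 'M[R]_(m, n)) : a <= b ->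
  {within `[a, b], continuous f} -> C1on a b (fun t => mxintegral a t f) f.
Proof.
move=> ab cf; apply: C1on_mx => i j.
have h := C1on_Rintegral ab (within_coord i j cf).
have e t : mxintegral a t f i j =
    (\int[lebesgue_measure]_(s in `[a, t]) f s i j)%R by rewrite mxE.
by apply: C1on_ext h => t _; rewrite e.
Qed.

Lemma mxintegral0 m n a (f : R -> 'M[R]_(m, n)) : mxintegral a a f = 0.
Proof. by apply/matrixP => i j; rewrite !mxE set_itv1 Rintegral_set1. Qed.

Lemma within_bounded m n a b (f : R -> 'M[R]_(m, n)) :
  {within `[a, b], continuous f} ->
  exists2 L : R, 0 < L & forall t, a <= t <= b -> forall i j, `|f t i j| <= L.
Proof.
move=> cf; have [ab|ba] := leP a b; last first.
  by exists 1 => // t /andP[h1 h2]; move: (le_lt_trans h2 ba); rewrite ltNge h1.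
have cn : {within `[a, b], continuous (fun t => `|f t|)}.
  by move=> t; apply: cvg_norm; exact: cf.
have [|c _ hc] := compact_EVT_max _ (@segment_compact _ a b) cn.
  by exists a; rewrite /= in_itv/= lexx.
exists (`|f c| + 1) => [|t tab i j]; first by rewrite ltr_wpDl.
have h : `|f t| <= `|f c| by apply: hc; rewrite inE/= in_itv.
rewrite (@le_trans _ _ `|f t|)//; last by rewrite (le_trans h)// lerDl.
rewrite [leRHS]/Num.Def.normr/= mx_normrE.
exact: (le_bigmax _ (fun p => `|f t p.1 p.2|) (i, j)).
Qed.

End Antiderivative.

(** * Picard iteration and time reversal *)

Section LinearODE.
Context {R : realType}.

(* The sequence u k - 2 E / 2 ^ k is nondecreasing, so the supremum is the limit
   of u. *)
Lemma geometric_cauchy (u : nat -> R) (E : R) :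
  (forall k, `|u k.+1 - u k| <= E / 2 ^+ k) ->
  forall k, `|sup (range (fun k => u k - 2 * E / 2 ^+ k)) - u k| <= 2 * E / 2 ^+ k.
Proof.
move=> h.
pose v k := u k - 2 * E / 2 ^+ k.
pose w k := u k + 2 * E / 2 ^+ k.
have half k : E / 2 ^+ k = 2 * E / 2 ^+ k.+1 by rewrite exprS; field.
have E0 k : 0 <= 2 * E / 2 ^+ k by rewrite -mulrA mulr_ge0 ?(le_trans _ (h k)).
have vS k : v k <= v k.+1.
  move: (h k); rewrite ler_norml => /andP[+ _]; rewrite /v.
  have e2 : 2 * E / 2 ^+ k = 2 * E / 2 ^+ k.+1 + 2 * E / 2 ^+ k.+1.
    by rewrite -half -mulrA; lra.
  rewrite half; lra.
have wS k : w k.+1 <= w k.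
  move: (h k); rewrite ler_norml => /andP[_]; rewrite /w.
  have e2 : 2 * E / 2 ^+ k = 2 * E / 2 ^+ k.+1 + 2 * E / 2 ^+ k.+1.
    by rewrite -half -mulrA; lra.
  rewrite half; lra.
have vm k j : (k <= j)%N -> v k <= v j.
  by move=> /subnK <-; elim: (j - k)%N => // i IH; rewrite addSn (le_trans IH).
have wm k j : (k <= j)%N -> w j <= w k.
  by move=> /subnK <-; elim: (j - k)%N => // i IH; rewrite addSn (le_trans _ IH).
have vw k : v k <= w k by rewrite /v /w; have := E0 k; lra.
have vwkj k j : v j <= w k.
  have [kj|/ltnW jk] := leqP k j; first by rewrite (le_trans (vw j))// wm.
  by rewrite (le_trans (vm _ _ jk)).
have hs : has_sup (range v).
  by split; [exists (v 0), 0|exists (w 0) => _ [j _ <-]].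
move=> k.
have h1 : v k <= sup (range v) by apply: ub_le_sup; [exact: hs.2|exists k].
have h2 : sup (range v) <= w k by apply: ge_sup; [exact: hs.1|move=> _ [j _ <-]].
rewrite ler_norml; move: h1 h2; rewrite {1}/v /w; lra.
Qed.

Lemma geometric_le0 (x K : R) : (forall k, x <= K / 2 ^+ k) -> x <= 0.
Proof.
move=> h; rewrite leNgt; apply/negP => x0.
have K0 : 0 < K by have := h 0; rewrite expr0 divr1; exact: lt_le_trans.
have [k hk] : exists k : nat, K / x < k%:R.
  exists (Num.truncn (K / x)).+1; exact: truncnS_gt.
have : (k%:R : R) < 2 ^+ k by rewrite -natrX ltr_nat ltn_expl.
move/(lt_trans hk); rewrite ltr_pdivrMr// => hK.
have := h k; rewrite ler_pdivlMr ?exprn_gt0// mulrC leNgt => /negP; apply.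
by [].
Qed.

Lemma submx_coord m n (A B : 'M[R]_(m, n)) i j : (A - B) i j = A i j - B i j.
Proof. by rewrite !mxE. Qed.

Lemma norm_mulmx_coord m n p (A : 'M[R]_(m, n)) (B : 'M[R]_(n, p)) (L e : R) :
  (forall i j, `|A i j| <= L) -> (forall i j, `|B i j| <= e) -> 0 <= L ->
  forall i j, `|(A *m B) i j| <= n%:R * L * e.
Proof.
move=> hA hB L0 i j; rewrite mxE (le_trans (ler_norm_sum _ _ _))//.
apply: (@le_trans _ _ (\sum_(k < n) L * e)).
  by apply: ler_sum => k _; rewrite normrM ler_pM.
by rewrite sumr_const card_ord -mulrA mulr_natl.
Qed.

Lemma C1on_norm_le (a b : R) (f f' g g' : R -> R) : a <= b -> f a = 0 -> 0 <= g a ->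
  C1on a b f f' -> C1on a b g g' ->
  (forall t, a < t < b -> `|f' t| <= g' t) ->
  forall t, a <= t <= b -> `|f t| <= g t.
Proof.
move=> ab fa ga hf hg h t /andP[at1 tb].
have hft := C1on_sub (lexx a) tb hf.
have hgt := C1on_sub (lexx a) tb hg.
have h' s : a < s < t -> `|f' s| <= g' s.
  by move=> /andP[h1 h2]; apply: h; rewrite h1 (lt_le_trans h2).
have le1 s : a < s < t -> f' s <= g' s.
  by move=> /h'; apply: le_trans; exact: ler_norm.
have le2 s : a < s < t -> - f' s <= g' s.
  by move=> /h'; apply: le_trans; rewrite -normrN; exact: ler_norm.
have := C1on_le at1 hft hgt le1.
have := C1on_le at1 (C1onN hft) hgt le2.
rewrite fa ler_norml; lra.
Qed.

(** Picard iteration on the whole interval at once: successive iterates differ by at most E / 2^k in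
    every entry, so they converge uniformly to a fixed point of [step]. *)
Lemma linear_ode n p (a b : R) (M : R -> 'M[R]_n) (g : R -> 'M[R]_(n, p)) c :
  a <= b ->
  {within `[a, b], continuous M} -> {within `[a, b], continuous g} ->
  exists2 y : R -> 'M[R]_(n, p),
    C1on a b y (fun t => M t *m y t + g t) & y a = c.
Proof.
move=> ab cM cg.
pose rhs (y : R -> 'M[R]_(n, p)) t := M t *m y t + g t.
pose step y t : 'M[R]_(n, p) := c + mxintegral a t (rhs y).
pose Y k := iter k step (fun=> c).
have crhs y : {within `[a, b], continuous y} -> {within `[a, b], continuous (rhs y)}.
  by move=> cy; apply: withinD => //; apply: within_mulmx.
have stepC y : {within `[a, b], continuous y} -> C1on a b (step y) (rhs y).
  move=> cy; apply: C1on_eq (C1onD (C1on_cst a b c) (C1on_mxintegral ab (crhs _ cy))).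
  by move=> t _ /=; rewrite add0r.
have stepa y : step y a = c by rewrite /step mxintegral0 addr0.
have cY k : {within `[a, b], continuous (Y k)}.
  by elim: k => [|k IH]; [exact: within_cst|exact: (stepC _ IH).1].
have [L0 L00 hL0] := within_bounded cM.
pose L := n%:R * L0 + 1.
have L_gt0 : 0 < L by rewrite /L ltr_wpDl// mulr_ge0// ltW.
have [C C0 hC] := within_bounded (withinB (cY 1) (cY 0)).
pose W t := expR (2 * L * (t - a)).
have dstep y z : {within `[a, b], continuous y} -> {within `[a, b], continuous z} ->
    C1on a b (fun t => step y t - step z t) (fun t => M t *m (y t - z t)).
  move=> cy cz; apply: C1on_eq (C1onB (stepC _ cy) (stepC _ cz)) => t _.
  by rewrite /rhs mulmxBr opprD addrACA subrr addr0.
have Mle (t : R) (B : 'M[R]_(n, p)) e : a <= t <= b -> (forall i j, `|B i j| <= e) ->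
    0 <= e -> forall i j, `|(M t *m B) i j| <= L * e.
  move=> tab hB e0 i j.
  rewrite (le_trans (norm_mulmx_coord (hL0 t tab) hB (ltW L00) i j))//.
  by rewrite ler_wpM2r// /L lerDl.
have ltW2 (t : R) : a < t < b -> a <= t <= b by case/andP => *; rewrite !ltW.
(* The weight exp (2 L (t - a)) makes a Picard step contract by the factor 1/2. *)
have diff k t : a <= t <= b -> forall i j, `|(Y k.+1 t - Y k t) i j| <= C / 2 ^+ k * W t.
  elim: k t => [|k IH] t tab i j.
    rewrite expr0 divr1; apply: le_trans (hC t tab i j) _.
    rewrite ler_peMr ?(ltW C0)// -expR0 ler_expR.
    by case/andP: tab => h _; rewrite mulr_ge0 ?subr_ge0 ?mulr_ge0 ?(ltW L_gt0).
  have hd := C1on_coord i j (dstep _ _ (cY k.+1) (cY k)).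
  have hW := C1onZ (C / 2 ^+ k.+1) (C1on_expR a b (2 * L) a).
  apply: (C1on_norm_le ab _ _ hd hW _ tab) => [||s sab].
  - by rewrite !stepa subrr mxE.
  - by rewrite subrr mulr0 expR0 mulr1 divr_ge0// ?exprn_ge0// ltW.
  - have := Mle s _ _ (ltW2 _ sab) (IH s (ltW2 _ sab)) _ i j.
    move=> /(_ _)/le_trans; apply.
      by rewrite mulr_ge0 ?expR_ge0// divr_ge0 ?exprn_ge0// ltW.
    by rewrite le_eqVlt; apply/orP; left; apply/eqP; rewrite /W exprS; field.
pose E := C * W b.
have diffE k t : a <= t <= b -> forall i j, `|Y k.+1 t i j - Y k t i j| <= E / 2 ^+ k.
  move=> tab i j; have := diff k t tab i j; rewrite submx_coord => /le_trans; apply.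
  rewrite /E [leRHS]mulrAC ler_wpM2l ?divr_ge0 ?exprn_ge0 ?(ltW C0)//.
  case/andP: tab => _ tb; rewrite /W ler_expR ler_wpM2l ?mulr_ge0 ?(ltW L_gt0)//.
  by rewrite lerB.
(* The entrywise limit, written as the supremum of [geometric_cauchy]. *)
pose y t : 'M[R]_(n, p) := \matrix_(i, j) sup (range (fun k => Y k t i j - 2 * E / 2 ^+ k)).
have yY k t : a <= t <= b -> forall i j, `|(y t - Y k t) i j| <= 2 * E / 2 ^+ k.
  move=> tab i j; rewrite submx_coord mxE.
  by apply: (@geometric_cauchy (fun k => Y k t i j)) => k'; exact: diffE.
have E_ge0 : 0 <= E by rewrite mulr_ge0 ?expR_ge0 ?ltW.
have EE k : 0 <= 2 * E / 2 ^+ k by rewrite divr_ge0 ?exprn_ge0// mulr_ge0.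
have cy : {within `[a, b], continuous y}.
  apply: within_mx => i j; apply/subspace_continuousP => t tab.
  apply/cvgrPdist_le => e e0.
  have [k hk] : exists k, 2 * E / 2 ^+ k <= e / 3.
    apply: contrapT => /forallNP h.
    have : e / 3 <= 0.
      by apply: (@geometric_le0 _ (2 * E)) => k; have /negP := h k; rewrite -ltNge => /ltW.
    by lra.
  have := within_coord i j (cY k) => /subspace_continuousP/(_ t tab)/cvgrPdist_le/(_ (e / 3)).
  move=> /(_ ltac:(lra)) hY.
  have h1 := yY k t; rewrite /= in_itv/= in tab; move: h1 => /(_ tab i j).
  rewrite submx_coord => h1.
  near=> s.
  have sab : a <= s <= b.
    have : `[a, b]%classic s by near: s; exact: withinT.
    by rewrite /= in_itv.
  have h2 := yY k s sab i j; rewrite submx_coord in h2.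
  have h3 : `|Y k t i j - Y k s i j| <= e / 3 by near: s.
  by rewrite /from_subspace/=; move: h1 h2 h3; rewrite !ler_norml; lra.
(* Both sides are close to [Y k.+1]: the left one because a step is Lipschitz with constant L (b -
   a), the right one by the tail bound. [K] collects the two contributions. *)
have fix_ t : a <= t <= b -> step y t = y t.
  move=> tab; apply/matrixP => i j; apply/eqP; rewrite -subr_eq0 -normr_le0.
  pose K := 2 * E * (L * (b - a) + 1).
  apply: (@geometric_le0 _ K) => k.
  have hd := C1on_coord i j (dstep _ _ cy (cY k)).
  have hlin : C1on a b (fun s => L * (2 * E / 2 ^+ k) * (s - a))
      (fun s => L * (2 * E / 2 ^+ k)).
    have idC : C1on a b (id : R -> R) (fun=> 1).
      by split; [apply: continuous_subspaceT => ?; exact: cvg_id|move=> s _; exact: is_derive_id].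
    apply: C1on_eq (C1onZ _ (C1onB idC (C1on_cst a b a))) => s _ /=.
    by rewrite subr0 mulr1.
  have le1 := C1on_norm_le ab _ _ hd hlin _ tab.
  have {}le1 : `|(step y t - step (Y k) t) i j| <= L * (2 * E / 2 ^+ k) * (t - a).
    apply: le1 => [||s sab].
    - by rewrite !stepa subrr mxE.
    - by rewrite subrr mulr0.
    - by apply: Mle => //; [exact: ltW2|exact: (yY k s (ltW2 _ sab))].
  have le2 := yY k.+1 t tab i j.
  have e1 : step y t i j - y t i j = (step y t - step (Y k) t) i j - (y t - Y k.+1 t) i j.
    by rewrite !submx_coord opprB addrA subrK.
  rewrite e1 (le_trans (ler_normB _ _))// (le_trans (lerD le1 le2))//.
  have e2 : K / 2 ^+ k = L * (2 * E / 2 ^+ k) * (b - a) + 2 * E / 2 ^+ k.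
    by rewrite /K; field; rewrite expf_neq0.
  have tb : t - a <= b - a by case/andP: tab => _ tb; rewrite lerB.
  have h1 : L * (2 * E / 2 ^+ k) * (t - a) <= L * (2 * E / 2 ^+ k) * (b - a).
    by apply: ler_wpM2l => //; apply: mulr_ge0 => //; exact: ltW.
  have h2 : 2 * E / 2 ^+ k.+1 <= 2 * E / 2 ^+ k.
    have : (2 ^+ k.+1)^-1 <= (2 ^+ k)^-1 :> R.
      by rewrite lef_pV2 ?posrE ?exprn_gt0// ler_eXn2l ?ltr1n.
    by move=> h; apply: ler_wpM2l => //; apply: mulr_ge0.
  by rewrite e2 lerD.
(* [step y] is differentiable by construction; it is only known to agree with [y] on [a, b], which
   is enough for the right-hand side. *)
exists (step y) => //.
apply: C1on_eq (stepC _ cy) => t /ltW2 tab.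
by rewrite /rhs fix_.
Unshelve. all: by end_near. Qed.

Lemma within_reflect (V : normedModType R) (a b : R) (f : R -> V) :
  {within `[a, b], continuous f} ->
  {within `[a, b], continuous (fun t => f (a + b - t))}.
Proof.
move=> cf; apply/subspace_continuousP => t; rewrite /= in_itv/= => tab.
have rab : `[a, b]%classic (a + b - t).
  by rewrite /= in_itv/=; case/andP: tab => *; apply/andP; split; lra.
move/subspace_continuousP : cf => /(_ _ rab) cf.
have cr : (fun s : R => a + b - s) @ within `[a, b]%classic (nbhs t) -->
    within `[a, b]%classic (nbhs (a + b - t)).
  move=> A [e /= e0 hA]; exists e => //= s /= ts sab.
  apply: hA => /=.
    by rewrite (_ : a + b - t - _ = s - t); [rewrite distrC|ring].
  by move: sab; rewrite !in_itv/= => /andP[*]; apply/andP; split; lra.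
exact: cvg_comp cr cf.
Qed.

Lemma C1on_reflect m n (a b : R) (f f' : R -> 'M[R]_(m, n)) : C1on a b f f' ->
  C1on a b (fun t => f (a + b - t)) (fun t => - f' (a + b - t)).
Proof.
move=> hf; apply: C1on_mx => i j; have [cf df] := C1on_coord i j hf.
split; first exact: (@within_reflect R a b (fun t => f t i j)).
move=> t tab.
have rab : a < a + b - t < b by case/andP: tab => *; apply/andP; split; lra.
have D := df _ rab.
have hr : is_derive t (1 : R) (fun s => a + b - s) (-1).
  have -> : (fun s => a + b - s) = cst (a + b) - id by apply/funext.
  have h := is_deriveB (is_derive_cst (a + b) t (1 : R)) (is_derive_id t (1 : R)).
  by apply: (is_derive_eq h); rewrite sub0r.
have h := @is_derive1_comp _ (fun t => f t i j) (fun s => a + b - s) t _ _ D hr.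
by apply: (is_derive_eq h); rewrite mxE mulrN1.
Qed.

(** The reflection t -> a + b - t preserves [a, b] and turns the terminal value problem into an
    initial value problem with the opposite sign. *)
Lemma linear_ode_backward n p (a b : R) (M : R -> 'M[R]_n) c :
  a <= b -> {within `[a, b], continuous M} ->
  exists2 y : R -> 'M[R]_(n, p), C1on a b y (fun t => M t *m y t) & y b = c.
Proof.
move=> ab cM.
have cN : {within `[a, b], continuous (fun t => - M (a + b - t))}.
  exact/withinN/within_reflect.
have [y hy ya] := linear_ode c ab cN (@within_cst _ _ a b (0 : 'M[R]_(n, p))).
exists (fun t => y (a + b - t)); last by rewrite addrK.
apply: C1on_eq (C1on_reflect hy) => t _.
by rewrite addr0 mulNmx opprK (_ : a + b - (a + b - t) = t)//; ring.
Qed.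

End LinearODE.

(** * Euclidean norm and matrix bounds *)

Section Euclidean.
Context {R : realType}.

Definition dot n (u v : 'cV[R]_n) : R := (u^T *m v) 0 0.

(** An upper bound of the operator norm as a plain inequality, so that products and sums are
    estimated without handling suprema. *)
Definition mxbound m n (M : 'M[R]_(m, n)) (k : R) : Prop :=
  forall x, enorm (M *m x) <= k * enorm x.

Lemma dotE n (u v : 'cV[R]_n) : dot u v = \sum_i u i 0 * v i 0.
Proof. by rewrite /dot mxE; apply: eq_bigr => i _; rewrite mxE. Qed.

Lemma dotC n (u v : 'cV[R]_n) : dot u v = dot v u.
Proof. by rewrite !dotE; apply: eq_bigr => i _; rewrite mulrC. Qed.

Lemma dotDl n (u v w : 'cV[R]_n) : dot (u + v) w = dot u w + dot v w.
Proof. by rewrite /dot linearD mulmxDl mxE. Qed.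

Lemma dotDr n (u v w : 'cV[R]_n) : dot w (u + v) = dot w u + dot w v.
Proof. by rewrite /dot mulmxDr mxE. Qed.

Lemma dotZl n (c : R) (u v : 'cV[R]_n) : dot (c *: u) v = c * dot u v.
Proof. by rewrite /dot linearZ/= -scalemxAl mxE. Qed.

Lemma dotZr n (c : R) (u v : 'cV[R]_n) : dot u (c *: v) = c * dot u v.
Proof. by rewrite dotC dotZl dotC. Qed.

Lemma dotNl n (u v : 'cV[R]_n) : dot (- u) v = - dot u v.
Proof. by rewrite -scaleN1r dotZl mulN1r. Qed.

Lemma dotNr n (u v : 'cV[R]_n) : dot u (- v) = - dot u v.
Proof. by rewrite dotC dotNl dotC. Qed.

Lemma dotBl n (u v w : 'cV[R]_n) : dot (u - v) w = dot u w - dot v w.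
Proof. by rewrite dotDl dotNl. Qed.

Lemma dotBr n (u v w : 'cV[R]_n) : dot w (u - v) = dot w u - dot w v.
Proof. by rewrite dotDr dotNr. Qed.

Lemma dot0r n (u : 'cV[R]_n) : dot u 0 = 0.
Proof. by rewrite /dot mulmx0 mxE. Qed.

Lemma dot0l n (u : 'cV[R]_n) : dot 0 u = 0.
Proof. by rewrite dotC dot0r. Qed.

Lemma dot_mulmxl m n (M : 'M[R]_(m, n)) u v : dot (M *m u) v = dot u (M^T *m v).
Proof. by rewrite /dot trmx_mul mulmxA. Qed.

Lemma dot_ge0 n (u : 'cV[R]_n) : 0 <= dot u u.
Proof. by rewrite dotE sumr_ge0// => i _; rewrite -expr2 sqr_ge0. Qed.

Lemma dot_eq0 n (u : 'cV[R]_n) : dot u u = 0 -> u = 0.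
Proof.
rewrite dotE => /eqP; rewrite psumr_eq0 => [/allP h|i _]; last by rewrite -expr2 sqr_ge0.
apply/matrixP => i j; rewrite ord1 mxE.
by have := h i (mem_index_enum _); rewrite mulf_eq0 orbb => /eqP.
Qed.

Lemma enorm_sqr n (u : 'cV[R]_n) : enorm u ^+ 2 = dot u u.
Proof.
rewrite /enorm sqr_sqrtr; first by rewrite dotE; apply: eq_bigr => i _; rewrite expr2.
by rewrite sumr_ge0// => i _; rewrite sqr_ge0.
Qed.

Lemma enorm_ge0 n (u : 'cV[R]_n) : 0 <= enorm u.
Proof. exact: sqrtr_ge0. Qed.

Lemma enorm_le n (u : 'cV[R]_n) (k : R) : 0 <= k -> (enorm u <= k) = (dot u u <= k ^+ 2).
Proof. by move=> k0; rewrite -enorm_sqr ler_pXn2r ?nnegrE ?enorm_ge0. Qed.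

Lemma enorm_eq0 n (u : 'cV[R]_n) : enorm u = 0 -> u = 0.
Proof. by move=> h; apply: dot_eq0; rewrite -enorm_sqr h expr0n. Qed.

Lemma enorm0 n : enorm (0 : 'cV[R]_n) = 0.
Proof. by apply/eqP; rewrite -sqrf_eq0 enorm_sqr dot0r. Qed.

Lemma enormZ n (c : R) (u : 'cV[R]_n) : enorm (c *: u) = `|c| * enorm u.
Proof.
apply/eqP; rewrite -(@eqrXn2 _ 2)// ?mulr_ge0 ?enorm_ge0//.
by rewrite exprMn !enorm_sqr dotZl dotZr mulrA -expr2 real_normK ?num_real.
Qed.

Lemma enormN n (u : 'cV[R]_n) : enorm (- u) = enorm u.
Proof. by rewrite -scaleN1r enormZ normrN1 mul1r. Qed.

Lemma cauchy_schwarz n (u v : 'cV[R]_n) : dot u v <= enorm u * enorm v.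
Proof.
have [u0|u0] := eqVneq (enorm u) 0.
  by rewrite u0 mul0r (enorm_eq0 u0) dot0l.
have [v0|v0] := eqVneq (enorm v) 0.
  by rewrite v0 mulr0 (enorm_eq0 v0) dot0r.
have up : 0 < enorm u by rewrite lt0r u0 enorm_ge0.
have vp : 0 < enorm v by rewrite lt0r v0 enorm_ge0.
(* Expanding this square gives 2 |u| |v| (|u| |v| - u^T v) >= 0. *)
have := dot_ge0 (enorm v *: u - enorm u *: v).
rewrite dotBl !dotBr !dotZl !dotZr (dotC v u) -!enorm_sqr.
set a := enorm u in up *; set b := enorm v in vp *; set d := dot u v => h.
have : 0 <= 2 * (a * b) * (a * b - d) by move: h; lra.
by rewrite pmulr_rge0 ?subr_ge0// mulr_gt0// mulr_gt0.
Qed.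

Lemma enormD n (u v : 'cV[R]_n) : enorm (u + v) <= enorm u + enorm v.
Proof.
rewrite enorm_le ?addr_ge0 ?enorm_ge0// dotDl !dotDr (dotC v u) -!enorm_sqr.
have := cauchy_schwarz u v; rewrite sqrrD mulr2n; lra.
Qed.

Lemma enormB n (u v : 'cV[R]_n) : enorm (u - v) <= enorm u + enorm v.
Proof. by rewrite -(enormN v) enormD. Qed.

(** Bounds a vector by testing it against itself. Estimates of vector-valued integrals thereby
    reduce to scalar differential inequalities. *)
Lemma enorm_dual n (u : 'cV[R]_n) (k : R) : 0 <= k ->
  dot u u <= k * enorm u -> enorm u <= k.
Proof.
move=> k0; have [->//|u0] := eqVneq (enorm u) 0.
have up : 0 < enorm u by rewrite lt0r u0 enorm_ge0.
by rewrite -enorm_sqr expr2 ler_pM2r.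
Qed.

Lemma mxboundM m n p (M : 'M[R]_(m, n)) (N : 'M[R]_(n, p)) k l : 0 <= k ->
  mxbound M k -> mxbound N l -> mxbound (M *m N) (k * l).
Proof.
move=> k0 hM hN x; rewrite -mulmxA (le_trans (hM _))// -mulrA ler_wpM2l//.
Qed.

Lemma mxboundD m n (M N : 'M[R]_(m, n)) k l :
  mxbound M k -> mxbound N l -> mxbound (M + N) (k + l).
Proof.
by move=> hM hN x; rewrite mulmxDl (le_trans (enormD _ _))// mulrDl lerD.
Qed.

Lemma mxboundN m n (M : 'M[R]_(m, n)) k : mxbound M k -> mxbound (- M) k.
Proof. by move=> hM x; rewrite mulNmx enormN. Qed.

Lemma mxbound_le m n (M : 'M[R]_(m, n)) k l : k <= l -> mxbound M k -> mxbound M l.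
Proof. by move=> kl hM x; rewrite (le_trans (hM x))// ler_wpM2r ?enorm_ge0. Qed.

Lemma mxbound_tr m n (M : 'M[R]_(m, n)) k : 0 <= k -> mxbound M k -> mxbound M^T k.
Proof.
move=> k0 hM z; have [->|nz] := eqVneq (enorm (M^T *m z)) 0.
  by rewrite mulr_ge0 ?enorm_ge0.
have p : 0 < enorm (M^T *m z) by rewrite lt0r nz enorm_ge0.
rewrite -(ler_pM2r p) -expr2 enorm_sqr dot_mulmxl trmxK.
apply: le_trans (cauchy_schwarz _ _) _.
by rewrite mulrAC mulrC ler_wpM2r ?enorm_ge0// hM.
Qed.

Lemma dot_mxbound n (M : 'M[R]_n) k x : mxbound M k -> dot x (M *m x) <= k * dot x x.
Proof.
move=> hM; apply: le_trans (cauchy_schwarz _ _) _.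
by rewrite mulrC -enorm_sqr expr2 mulrA ler_wpM2r ?enorm_ge0.
Qed.

Lemma loewner_leP n (M N : 'M[R]_n) :
  loewner_le M N <-> forall v, dot v (M *m v) <= dot v (N *m v).
Proof.
have e v : (v^T *m (N - M) *m v) 0 0 = dot v (N *m v) - dot v (M *m v).
  by rewrite -mulmxA mulmxBl -dotBr.
by split=> h v; have := h v; rewrite e subr_ge0.
Qed.

Lemma dot_scalar_mx n (c : R) (v : 'cV[R]_n) : dot v (c%:M *m v) = c * dot v v.
Proof. by rewrite mul_scalar_mx dotZr. Qed.

(** Cauchy-Schwarz turns coercivity into g |x| <= |M x|, which gives both injectivity and the bound
    of the inverse. *)
Lemma coercive_inv n (M : 'M[R]_n) (g : R) : 0 < g ->
  (forall x, g * dot x x <= dot x (M *m x)) ->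
  M \in unitmx /\ mxbound (invmx M) g^-1.
Proof.
move=> g0 h.
have lb x : g * enorm x <= enorm (M *m x).
  have [->|nz] := eqVneq (enorm x) 0; first by rewrite mulr0 enorm_ge0.
  have p : 0 < enorm x by rewrite lt0r nz enorm_ge0.
  rewrite -(ler_pM2r p) -mulrA -expr2 enorm_sqr (le_trans (h x))// mulrC.
  exact: cauchy_schwarz.
have u : M \in unitmx.
  rewrite -unitmx_tr -row_free_unit; apply: inj_row_free => v vM.
  have : M *m v^T = 0 by rewrite -[M]trmxK -trmx_mul vM trmx0.
  move=> hv; have := lb v^T; rewrite hv enorm0 pmulr_rle0// => le0.
  have : v^T = 0 by apply: enorm_eq0; apply/eqP; rewrite eq_le le0 enorm_ge0.
  by move/(congr1 trmx); rewrite trmxK trmx0.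
split=> // y; have := lb (invmx M *m y).
by rewrite mulmxA mulmxV// mul1mx ler_pdivlMl.
Qed.

Lemma mxbound_opnorm m n (M : 'M[R]_(m, n)) : mxbound M (opnorm M).
Proof.
(* The supremum in [opnorm] is an upper bound only once its set is known to be bounded; the
   Frobenius norm shows this. *)
have [K K0 hK] : exists2 K : R, 0 <= K & mxbound M K.
  exists (Num.sqrt (\sum_i \sum_j M i j ^+ 2)); first exact: sqrtr_ge0.
  move=> x.
  have S0 : 0 <= \sum_i \sum_j M i j ^+ 2.
    by apply: sumr_ge0 => i _; apply: sumr_ge0 => j _; rewrite sqr_ge0.
  rewrite enorm_le ?mulr_ge0 ?sqrtr_ge0 ?enorm_ge0//.
  rewrite exprMn sqr_sqrtr// enorm_sqr dotE mulr_suml.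
  apply: ler_sum => i _.
  have e : (M *m x) i 0 = dot (row i M)^T x.
    by rewrite dotE mxE; apply: eq_bigr => j _; rewrite !mxE.
  have e2 : \sum_j M i j ^+ 2 = enorm (row i M)^T ^+ 2.
    by rewrite enorm_sqr dotE; apply: eq_bigr => j _; rewrite !mxE expr2.
  rewrite e e2 -enorm_sqr -exprMn -expr2 -[leLHS]real_normK ?num_real//.
  rewrite ler_pXn2r ?nnegrE ?mulr_ge0 ?enorm_ge0//.
  by rewrite ler_norml cauchy_schwarz lerNl -dotNr -(enormN x) cauchy_schwarz.
have ub : has_ubound [set enorm (M *m v) | v in [set v : 'cV[R]_n | enorm v <= 1]].
  exists K => _ [v /= v1 <-]; rewrite (le_trans (hK v))//.
  by rewrite -[leRHS]mulr1 ler_wpM2l.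
move=> x; have [x0|nz] := eqVneq (enorm x) 0.
  by rewrite x0 mulr0 (enorm_eq0 x0) mulmx0 enorm0.
have p : 0 < enorm x by rewrite lt0r nz enorm_ge0.
rewrite -ler_pdivrMr//; apply: ub_le_sup => //.
exists ((enorm x)^-1 *: x) => /=.
  by rewrite enormZ ger0_norm ?invr_ge0 ?enorm_ge0// mulVf.
by rewrite -scalemxAr enormZ ger0_norm ?invr_ge0 ?enorm_ge0// mulrC.
Qed.

Lemma mxbound_supnorm m n (T k : R) (M : R -> 'M[R]_(m, n)) :
  (supnorm (@opnorm R _ _) T M <= k%:E)%E ->
  forall t, 0 <= t <= T -> mxbound (M t) k.
Proof.
move=> h t tT; apply: mxbound_le (@mxbound_opnorm _ _ (M t)).
rewrite -lee_fin; apply: le_trans h; apply: ereal_sup_ubound.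
by exists t.
Qed.

End Euclidean.

(** * Hamiltonian systems *)

Lemma C1on_dot (R : realType) n (a b : R) (x y x' y' : R -> 'cV[R]_n) :
  C1on a b x x' -> C1on a b y y' ->
  C1on a b (fun t => dot (x t) (y t)) (fun t => dot (x' t) (y t) + dot (x t) (y' t)).
Proof.
move=> hx hy; have h := C1on_coord 0 0 (C1on_mulmx (C1on_tr hx) hy).
by apply: C1on_eq h => t _; rewrite mxE.
Qed.

Section Hamiltonian.
Context {R : realType} {n : nat}.
Variables (a b : R) (F G Q : R -> 'M[R]_n) (K : 'M[R]_n).

(** With [p] columns, one definition covers both vector solutions and the fundamental pair (X,
    L). *)
Definition hamiltonian p (x l : R -> 'M[R]_(n, p)) : Prop :=
  C1on a b x (fun t => F t *m x t - G t *m l t) /\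
  C1on a b l (fun t => - ((F t)^T *m l t) - Q t *m x t).

Lemma hamiltonianM p q (x l : R -> 'M[R]_(n, p)) (c : 'M[R]_(p, q)) :
  hamiltonian x l -> hamiltonian (fun t => x t *m c) (fun t => l t *m c).
Proof.
move=> [hx hl]; split.
  by apply: C1on_eq (C1on_mulmxr c hx) => t _; rewrite mulmxBl !mulmxA.
by apply: C1on_eq (C1on_mulmxr c hl) => t _; rewrite mulmxBl mulNmx !mulmxA.
Qed.

Hypotheses (ab : a <= b).
Hypotheses (cF : {within `[a, b], continuous F}) (cG : {within `[a, b], continuous G})
  (cQ : {within `[a, b], continuous Q}).

Lemma hamiltonian_exists p (x1 l1 : 'M[R]_(n, p)) :
  exists x l, [/\ hamiltonian x l, x b = x1 & l b = l1].
Proof.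
(* [E1], [E2] are the injections of the two components into the doubled space and [T1], [T2] the
   projections; the system matrix is assembled from them. *)
pose E1 : 'M[R]_(n + n, n) := col_mx 1%:M 0.
pose E2 : 'M[R]_(n + n, n) := col_mx 0 1%:M.
pose T1 : 'M[R]_(n, n + n) := row_mx 1%:M 0.
pose T2 : 'M[R]_(n, n + n) := row_mx 0 1%:M.
have e11 : T1 *m E1 = 1%:M by rewrite mul_row_col mul1mx mul0mx addr0.
have e22 : T2 *m E2 = 1%:M by rewrite mul_row_col mul1mx mul0mx add0r.
have e12 : T1 *m E2 = 0 by rewrite mul_row_col mulmx0 mul0mx addr0.
have e21 : T2 *m E1 = 0 by rewrite mul_row_col mulmx0 mul0mx addr0.
pose M t := E1 *m (F t *m T1 - G t *m T2) - E2 *m ((F t)^T *m T2 + Q t *m T1).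
have cst (V : normedModType R) (c : V) : {within `[a, b], continuous (fun=> c)}.
  exact: within_cst.
have cM : {within `[a, b], continuous M}.
  have cl := withinB (within_mulmx cF (cst _ T1)) (within_mulmx cG (cst _ T2)).
  have cr := withinD (within_mulmx (within_tr cF) (cst _ T2)) (within_mulmx cQ (cst _ T1)).
  exact: withinB (within_mulmx (cst _ E1) cl) (within_mulmx (cst _ E2) cr).
have [y hy yb] := linear_ode_backward (E1 *m x1 + E2 *m l1) ab cM.
exists (fun t => T1 *m y t), (fun t => T2 *m y t); split.
- split.
    apply: C1on_eq (C1on_mulmxl T1 hy) => t _.
    rewrite mulmxA /M mulmxBr !mulmxA e11 e12 mul1mx !mul0mx subr0.
    by rewrite mulmxBl -!mulmxA.
  apply: C1on_eq (C1on_mulmxl T2 hy) => t _.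
  rewrite mulmxA /M mulmxBr !mulmxA e21 e22 !mul0mx mul1mx sub0r.
  by rewrite mulNmx mulmxDl opprD -!mulmxA.
- by rewrite yb mulmxDr !mulmxA e11 e12 mul1mx mul0mx addr0.
- by rewrite yb mulmxDr !mulmxA e21 e22 mul1mx mul0mx add0r.
Qed.

Variables gQ bet kap c0 c1 : R.
Hypotheses (symG : forall t : R, a <= t <= b -> (G t)^T = G t)
  (symQ : forall t, a <= t <= b -> (Q t)^T = Q t) (symK : K^T = K).
Hypotheses (Gge0 : forall t, a <= t <= b -> forall y, 0 <= dot y (G t *m y))
  (Gle : forall t, a <= t <= b -> mxbound (G t) bet)
  (Qge : forall t, a <= t <= b -> forall y, gQ * dot y y <= dot y (Q t *m y))
  (Fle : forall t, a <= t <= b -> mxbound (F t) kap)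
  (Kge : forall y, gQ * dot y y <= dot y (K *m y)).
Hypotheses (gQ_gt0 : 0 < gQ) (bet_ge0 : 0 <= bet) (c0_gt0 : 0 < c0) (c1_gt0 : 0 < c1)
  (c0_gQ : c0 <= gQ) (c0_riccati : 2 * kap * c0 + c0 ^+ 2 * bet <= gQ).
(** With l = P x, this follows from (x - y)^T P (x - y) >= 0 and y^T P y <= c1 |y|^2. It is kept
    abstract here, since its proof needs the controllability of the original system. *)
Hypothesis value_upper : forall x l : R -> 'cV[R]_n,
  hamiltonian x l -> l b = K *m x b ->
  forall t, a <= t <= b -> forall y, 2 * dot (l t) y <= dot (x t) (l t) + c1 * dot y y.

Let cZ := Num.sqrt (c1 / c0).
Let rho := gQ / (2 * c1).

Let ltW2 t : a < t < b -> a <= t <= b.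
Proof. by case/andP => *; rewrite !ltW. Qed.

Let rho_gt0 : 0 < rho.
Proof. by rewrite divr_gt0// mulr_gt0. Qed.

Let cZ_ge0 : 0 <= cZ.
Proof. exact: sqrtr_ge0. Qed.

Lemma C1on_value (x l : R -> 'cV[R]_n) : hamiltonian x l ->
  C1on a b (fun t => dot (x t) (l t))
    (fun t => - dot (l t) (G t *m l t) - dot (x t) (Q t *m x t)).
Proof.
move=> [hx hl]; apply: C1on_eq (C1on_dot hx hl) => t _.
by rewrite dotBl !dotBr dotNr dot_mulmxl (dotC (G t *m _)); ring.
Qed.

(** * Solutions with exact terminal condition l(b) = K x(b) *)

Section Terminal.
Variables x l : R -> 'cV[R]_n.
Hypotheses (hxl : hamiltonian x l) (hb : l b = K *m x b).

(* The assumption c0_riccati makes the constant c0 a subsolution of the Riccati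
   equation. *)
Lemma value_lower t : a <= t <= b -> c0 * dot (x t) (x t) <= dot (x t) (l t).
Proof.
move=> /andP[at1 tb].
have [hx hl] := hxl.
have hV := C1on_value hxl.
have hN := C1onZ c0 (C1on_dot hx hx).
have le s : t < s < b ->
    - dot (l s) (G s *m l s) - dot (x s) (Q s *m x s) <=
    c0 * (dot (F s *m x s - G s *m l s) (x s) + dot (x s) (F s *m x s - G s *m l s)).
  move=> /andP[ts sb]; have sab : a <= s <= b by rewrite (le_trans at1 (ltW ts)) ltW.
  (* This square bounds - l^T G l by - 2 c0 x^T G l + c0^2 x^T G x. The mixed term is the one in the
     derivative of c0 |x|^2, and [c0_riccati] absorbs the rest into x^T Q x. *)
  have h1 := Gge0 sab (l s - c0 *: x s).
  have h2 := dot_mxbound (x s) (Gle sab).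
  have h3 := dot_mxbound (x s) (mxboundN (Fle sab)).
  have h4 := Qge sab (x s).
  have e : dot (l s) (G s *m x s) = dot (x s) (G s *m l s).
    by rewrite dotC dot_mulmxl symG.
  rewrite mulmxBr -scalemxAr dotBl !dotBr !dotZl !dotZr e in h1.
  rewrite mulNmx dotNr in h3.
  rewrite (dotC _ (x s)) dotBr.
  have n0 := dot_ge0 (x s).
  have h5 : (2 * kap * c0 + c0 ^+ 2 * bet) * dot (x s) (x s) <= gQ * dot (x s) (x s).
    by rewrite ler_wpM2r.
  have h6 : c0 ^+ 2 * dot (x s) (G s *m x s) <= c0 ^+ 2 * (bet * dot (x s) (x s)).
    by rewrite ler_wpM2l// sqr_ge0.
  have h7 : c0 * - dot (x s) (F s *m x s) <= c0 * (kap * dot (x s) (x s)).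
    by rewrite ler_wpM2l// ltW.
  rewrite expr2 in h5 h6; lra.
have := C1on_le tb (C1on_sub at1 (lexx b) hV) (C1on_sub at1 (lexx b) hN) le.
have : c0 * dot (x b) (x b) <= dot (x b) (l b).
  by rewrite hb (le_trans _ (Kge _))// ler_wpM2r// dot_ge0.
lra.
Qed.

(** The choice y = l / c1 in [value_upper] is optimal and gives |l|^2 <= c1 x^T l. *)
Lemma adjoint_upper t : a <= t <= b -> enorm (l t) <= c1 * enorm (x t).
Proof.
move=> tab; apply: enorm_dual; first by rewrite mulr_ge0 ?enorm_ge0// ltW.
have h := value_upper hxl hb tab (c1^-1 *: l t).
rewrite !dotZr dotZl in h.
have h1 : dot (l t) (l t) <= c1 * dot (x t) (l t).
  rewrite -ler_pdivrMl//; move: h.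
  by rewrite mulVKf ?gt_eqF//; lra.
by rewrite (le_trans h1)// -mulrA ler_wpM2l ?(ltW c1_gt0)// cauchy_schwarz.
Qed.

Lemma value_le t : a <= t <= b -> dot (x t) (l t) <= c1 * dot (x t) (x t).
Proof.
move=> tab; rewrite (le_trans (cauchy_schwarz _ _))// -enorm_sqr expr2 mulrCA.
by rewrite ler_wpM2l ?enorm_ge0// adjoint_upper.
Qed.

(** Since 2 rho V = (gQ / c1) V <= gQ |x|^2 <= - V', the function e^(2 rho (r - s)) V(r) is
    nonincreasing. Sandwiching V between c0 |x|^2 and c1 |x|^2 costs the factor c1 / c0, whose
    square root is [cZ]. *)
Lemma state_decay s t : a <= s -> s <= t -> t <= b ->
  enorm (x t) <= cZ * expR (- rho * (t - s)) * enorm (x s).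
Proof.
move=> as1 st tb.
have hV := C1onM (C1on_expR a b (2 * rho) s) (C1on_value hxl).
have h0 := C1on_cst a b (0 : R).
have le r : s < r < t ->
    2 * rho * expR (2 * rho * (r - s)) * dot (x r) (l r) +
    expR (2 * rho * (r - s)) *
      (- dot (l r) (G r *m l r) - dot (x r) (Q r *m x r)) <= 0.
  move=> /andP[sr rt]; have rab : a <= r <= b.
    by rewrite (le_trans as1 (ltW sr)) (le_trans (ltW rt)).
  rewrite mulrAC mulrC -mulrDr pmulr_rle0 ?expR_gt0//.
  have h1 := Gge0 rab (l r).
  have h2 := Qge rab (x r).
  have h3 : 2 * rho * dot (x r) (l r) <= gQ * dot (x r) (x r).
    have -> : 2 * rho = gQ / c1 by rewrite /rho; field; rewrite gt_eqF.
    by rewrite -mulrA ler_wpM2l ?(ltW gQ_gt0)// ler_pdivrMl// value_le// rab.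
  lra.
have := C1on_le st (C1on_sub as1 tb hV) (C1on_sub as1 tb h0) le.
rewrite !subrr mulr0 expR0 mul1r subr_le0 => h.
have tab : a <= t <= b by rewrite (le_trans as1).
have sab : a <= s <= b by rewrite as1 (le_trans st).
have e2 : expR (2 * rho * (t - s)) = (expR (- rho * (t - s)))^-2.
  by rewrite -expRM_natl -expRN; congr expR; ring.
have h1 : c0 * dot (x t) (x t) <= expR (- rho * (t - s)) ^+ 2 * (c1 * dot (x s) (x s)).
  rewrite (le_trans (value_lower tab))// -ler_pdivrMl ?exprn_gt0 ?expR_gt0//.
  by rewrite -e2 (le_trans h)// value_le.
rewrite enorm_le ?mulr_ge0 ?expR_ge0 ?enorm_ge0// !exprMn enorm_sqr.
rewrite sqr_sqrtr ?divr_ge0 ?(ltW c1_gt0) ?(ltW c0_gt0)//.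
rewrite -(ler_pM2l c0_gt0) (le_trans h1)// le_eqVlt; apply/orP; left; apply/eqP.
by field; rewrite gt_eqF.
Qed.

End Terminal.

Theorem hamiltonian_decay (x l : R -> 'cV[R]_n) (d : 'cV[R]_n) :
  hamiltonian x l -> l b = K *m x b + d ->
  forall t, a <= t <= b ->
  enorm (x t) <= cZ * expR (- rho * (t - a)) * enorm (x a)
     + bet * cZ ^+ 2 / (2 * rho) * expR (- rho * (b - t)) * enorm d /\
  enorm (l t) <= c1 * enorm (x t) + cZ * expR (- rho * (b - t)) * enorm d.
Proof.
move=> hxl hb.
have [X [L [hXL Xb Lb]]] := hamiltonian_exists (1%:M : 'M[R]_n) K.
have term (c : 'cV[R]_n) : L b *m c = K *m (X b *m c) by rewrite Xb Lb mul1mx.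
have Xu t : a <= t <= b -> X t \in unitmx.
  move=> /andP[at1 tb].
  rewrite -unitmx_tr -row_free_unit; apply: inj_row_free => v vM.
  have hv : X t *m v^T = 0 by rewrite -[X t]trmxK -trmx_mul vM trmx0.
  have := state_decay (hamiltonianM v^T hXL) (term _) at1 tb (lexx b).
  rewrite hv enorm0 mulr0 Xb mul1mx => le0.
  have : v^T = 0 by apply: enorm_eq0; apply/eqP; rewrite eq_le le0 enorm_ge0.
  by move/(congr1 trmx); rewrite trmxK trmx0.
have [hX hL] := hXL.
(* The closed-loop matrix, for which X' = Fcl X. Its inverse [Y] must satisfy Y' = - Y Fcl. *)
pose Fcl t := F t - G t *m (L t *m invmx (X t)).
have cFcl : {within `[a, b], continuous (fun t => - (Fcl t)^T)}.
  apply/withinN/within_tr/withinB => //; apply: within_mulmx => //.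
  by apply: within_mulmx; [exact: hL.1|apply: within_invmx => //; exact: hX.1].
(* Solving the closed-loop equation for X^-1 avoids differentiating an inverse. *)
have [Yt hYt Ytb] := linear_ode_backward (1%:M : 'M[R]_n) ab cFcl.
pose Y t := (Yt t)^T.
have hY : C1on a b Y (fun t => - (Y t *m Fcl t)).
  by apply: C1on_eq (C1on_tr hYt) => t _; rewrite mulNmx linearN/= trmx_mul trmxK.
have bab : a <= b <= b by rewrite ab lexx.
have YX t : a <= t <= b -> Y t *m X t = 1%:M.
  move=> tab; have hc : C1on a b (fun t => Y t *m X t) (fun=> 0).
    apply: C1on_eq (C1on_mulmx hY hX) => s sab.
    rewrite /Fcl mulNmx mulmxBr mulmxBl opprB mulmxBr -!mulmxA mulVmx ?mulmx1 ?Xu ?ltW2//.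
    by rewrite addrA subrK subrr.
  by rewrite (C1on_const hc tab bab) Xb mulmx1 /Y Ytb trmx1.
have XY t : a <= t <= b -> X t *m Y t = 1%:M by move=> /YX/mulmx1C.
have YE t : a <= t <= b -> invmx (X t) = Y t.
  by move=> tab; rewrite -[LHS]mul1mx -(YX _ tab) mulmxK// Xu.
have XYle s t : a <= s -> s <= t -> t <= b ->
    mxbound (X t *m Y s) (cZ * expR (- rho * (t - s))).
  move=> as1 st tb y; rewrite -mulmxA.
  have := state_decay (hamiltonianM (Y s *m y) hXL) (term _) as1 st tb.
  by rewrite (mulmxA (X s)) XY ?mul1mx ?as1 ?(le_trans st).
(* As X(b) = 1, Y(t) is the closed-loop evolution from t to b. *)
have Yle t : a <= t <= b -> mxbound (Y t)^T (cZ * expR (- rho * (b - t))).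
  move=> /andP[at1 tb]; apply: mxbound_tr; first by rewrite mulr_ge0 ?expR_ge0.
  by have := XYle t b at1 tb (lexx b); rewrite Xb mul1mx.
have [hx hl] := hxl.
(* Two solutions of a Hamiltonian system have a constant symplectic product. *)
have pair p (x' l' : R -> 'M[R]_(n, p)) : hamiltonian x' l' -> forall t, a <= t <= b ->
    (X t)^T *m l' t - (L t)^T *m x' t = (X b)^T *m l' b - (L b)^T *m x' b.
  move=> [hx' hl'] t tab.
  have hc : C1on a b (fun t => (X t)^T *m l' t - (L t)^T *m x' t) (fun=> 0).
    apply: C1on_eq (C1onB (C1on_mulmx (C1on_tr hX) hl') (C1on_mulmx (C1on_tr hL) hx')).
    move=> s /ltW2 sab.
    have e1 : (F s *m X s - G s *m L s)^T = (X s)^T *m (F s)^T - (L s)^T *m G s.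
      by rewrite linearB/= !trmx_mul symG.
    have e2 : (- ((F s)^T *m L s) - Q s *m X s)^T = - ((L s)^T *m F s) - (X s)^T *m Q s.
      by rewrite linearB linearN/= !trmx_mul trmxK symQ.
    rewrite e1 e2 !(mulmxBl, mulmxBr, mulNmx, mulmxN) !mulmxA.
    move: (_ *m _ *m l' s) (_ *m _ *m l' s) (_ *m _ *m x' s) (_ *m _ *m x' s).
    by move=> A1 A2 A3 A4; apply/matrixP => i j; rewrite !mxE; ring.
  exact: (C1on_const hc tab bab).
have hd t : a <= t <= b -> (X t)^T *m l t - (L t)^T *m x t = d.
  by move=> tab; rewrite (pair _ _ _ hxl)// hb Xb Lb symK trmx1 mul1mx addrAC subrr add0r.
(* The pair (X, L) paired with itself: L X^-1 is symmetric because K is. This allows the next step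
   to solve X^T l - L^T x = d for l. *)
have sL t : a <= t <= b -> (X t)^T *m L t = (L t)^T *m X t.
  move=> tab; apply/eqP; rewrite -subr_eq0 (pair _ _ _ hXL)// Xb Lb symK trmx1.
  by rewrite mul1mx mulmx1 subrr.
have zE t : a <= t <= b -> l t - L t *m (Y t *m x t) = (Y t)^T *m d.
  move=> tab; rewrite -[LHS]mul1mx -trmx1 -(XY _ tab) trmx_mul -mulmxA; congr (_ *m _).
  rewrite mulmxBr !mulmxA sL// -(mulmxA _ (X t)) XY// mulmx1; exact: hd.
have zle t : a <= t <= b ->
    enorm (l t - L t *m (Y t *m x t)) <= cZ * expR (- rho * (b - t)) * enorm d.
  by move=> tab; rewrite zE//; exact: Yle.
move=> t tab; have /andP[at1 tb] := tab; split; last first.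
  rewrite -[l t](subrK (L t *m (Y t *m x t))) addrC (le_trans (enormD _ _))//.
  rewrite lerD ?zle//.
  have := adjoint_upper (hamiltonianM (Y t *m x t) hXL) (term _) tab.
  by rewrite [in X t *m _]mulmxA XY// mul1mx.
(* |x(t)|^2 is the value at s = t of the scalar function [f] below, whose value at s = a contains
   only the evolved initial state. Its derivative carries only the defect l - L Y x. *)
apply: enorm_dual.
  have r0 : 0 <= (2 * rho)^-1 by rewrite invr_ge0 mulr_ge0// ltW.
  by apply: addr_ge0; rewrite !mulr_ge0 ?exprn_ge0 ?expR_ge0 ?enorm_ge0.
pose f s := dot (x t) (X t *m (Y s *m x s)).
have hf : C1on a t f (fun s => - dot (x t) (X t *m (Y s *m (G s *m (l s - L s *m (Y s *m x s)))))).
  have hYx := C1on_mulmx hY hx.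
  have := C1on_dot (C1on_cst a b (x t)) (C1on_mulmxl (X t) hYx).
  move=> /(C1on_sub (lexx a) tb); apply: C1on_eq => s /andP[as1 st].
  have sab : a <= s <= b by rewrite !ltW// (lt_le_trans st).
  have e : - (Y s *m Fcl s) *m x s + Y s *m (F s *m x s - G s *m l s) =
      - (Y s *m (G s *m (l s - L s *m (Y s *m x s)))).
    rewrite /Fcl YE// mulNmx mulmxBr mulmxBl !mulmxBr !mulmxA !opprB.
    by rewrite addrA subrK.
  by rewrite dot0l add0r e mulmxN dotNr.
pose C := enorm (x t) * (cZ ^+ 2 * bet * enorm d).
(* Centred at (t + b) / 2, the exponential is the product of the two decay factors e^(-rho (t - s))
   and e^(-rho (b - s)). *)
have hg := C1onZ (C / (2 * rho)) (C1on_expR a t (2 * rho) ((t + b) / 2)).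
have le s : a < s < t ->
    - dot (x t) (X t *m (Y s *m (G s *m (l s - L s *m (Y s *m x s))))) <=
    C / (2 * rho) * (2 * rho * expR (2 * rho * (s - (t + b) / 2))).
  move=> /andP[as1 st].
  have sab : a <= s <= b by rewrite !ltW// (lt_le_trans st).
  rewrite -dotNr (le_trans (cauchy_schwarz _ _))// enormN.
  have -> : C / (2 * rho) * (2 * rho * expR (2 * rho * (s - (t + b) / 2))) =
      enorm (x t) * (cZ * expR (- rho * (t - s)) * (bet * (cZ * expR (- rho * (b - s)) * enorm d))).
    have -> : expR (2 * rho * (s - (t + b) / 2)) = expR (- rho * (t - s)) * expR (- rho * (b - s)).
      by rewrite -expRD; congr expR; field.
    by rewrite /C; field; rewrite gt_eqF.
  rewrite ler_wpM2l ?enorm_ge0// mulmxA.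
  apply: le_trans (XYle s t (ltW as1) (ltW st) tb _) _.
  rewrite ler_wpM2l ?mulr_ge0 ?expR_ge0//.
  apply: le_trans (Gle sab _) _.
  by rewrite ler_wpM2l// zle.
have := C1on_le at1 hf hg le.
have fa : f a <= enorm (x t) * (cZ * expR (- rho * (t - a)) * enorm (x a)).
  rewrite /f (le_trans (cauchy_schwarz _ _))// ler_wpM2l ?enorm_ge0// mulmxA.
  by apply: XYle.
have ft : f t = dot (x t) (x t) by rewrite /f mulmxA XY// mul1mx.
have ga : 0 <= C / (2 * rho) * expR (2 * rho * (a - (t + b) / 2)).
  have r0 : 0 <= (2 * rho)^-1 by rewrite invr_ge0 mulr_ge0// ltW.
  by rewrite /C !mulr_ge0 ?exprn_ge0 ?expR_ge0 ?enorm_ge0.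
have gt : C / (2 * rho) * expR (2 * rho * (t - (t + b) / 2)) =
    bet * cZ ^+ 2 / (2 * rho) * expR (- rho * (b - t)) * enorm d * enorm (x t).
  have -> : 2 * rho * (t - (t + b) / 2) = - rho * (b - t) by field.
  by rewrite /C; field; rewrite gt_eqF.
rewrite gt ft mulrDl (mulrC _ (enorm (x t))) in fa ga *; lra.
Qed.

End Hamiltonian.

(** * First-order optimality *)

Section QuadraticCost.
Context {R : realType}.

(** Common form of all terminal costs: M = Q(b), r = Q(b) q for inner subdomains, and M = QT, r = 0
    for the last one and for the full problem. *)
Definition quadratic n (M : 'M[R]_n) (r x : 'cV[R]_n) : R :=
  2^-1 * dot x (M *m x) - dot x r.

Lemma quadratic_expansion n (M : 'M[R]_n) (r x v : 'cV[R]_n) (e : R) : M^T = M ->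
  quadratic M r (x + e *: v) =
  quadratic M r x + e * dot (M *m x - r) v + e ^+ 2 * (2^-1 * dot v (M *m v)).
Proof.
move=> sM; rewrite /quadratic mulmxDr !dotDl !dotDr -scalemxAr !dotZl !dotZr dotNl.
have -> : dot v (M *m x) = dot (M *m x) v by rewrite dotC.
have -> : dot x (M *m v) = dot (M *m x) v by rewrite dot_mulmxl sM.
by rewrite (dotC r v); field.
Qed.

Lemma derive_quadratic n (f : 'cV[R]_n -> R) (x v : 'cV[R]_n) (p q : R) :
  (forall e, f (x + e *: v) = f x + e * p + e ^+ 2 * q) -> 'D_v f x = p.
Proof.
move=> h; rewrite /derive; apply: cvg_lim => //.
have c : (fun e : R => p + e * q) @ 0^' --> p.
  rewrite -[X in _ --> X]addr0 -[X in _ --> _ + X](mul0r q).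
  apply: cvgD; first exact: cvg_cst.
  apply: cvgM; last exact: cvg_cst.
  exact: nbhs_dnbhs.
apply: cvg_trans c; apply: near_eq_cvg; near=> e.
have e0 : e != 0 by near: e; exact: nbhs_dnbhs_neq.
rewrite /= [e *: v + x]addrC h /GRing.scale/=.
by field.
Unshelve. all: by end_near. Qed.

Lemma gradient_quadratic n (M : 'M[R]_n) (r x : 'cV[R]_n) : M^T = M ->
  gradient (quadratic M r) x = M *m x - r.
Proof.
move=> sM; apply/matrixP => i j; rewrite ord1 mxE.
rewrite (derive_quadratic (fun e => quadratic_expansion r x (delta_mx i 0) e sM)).
rewrite dotE (bigD1 i)//= big1 => [|k ki]; last by rewrite [delta_mx _ _ _ _]mxE (negbTE ki) mulr0.
by rewrite [delta_mx _ _ _ _]mxE !eqxx mulr1 addr0.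
Qed.

Lemma linear_term_eq0 (p q : R) : (forall e : R, 0 <= e * p + e ^+ 2 * q) -> p = 0.
Proof.
move=> h; apply/eqP; rewrite eq_le.
have q1 : 0 < `|q| + 1 by rewrite ltr_wpDl.
have key (s : R) : s = 1 \/ s = -1 -> 0 <= s * p.
  move=> hs; rewrite leNgt; apply/negP => neg.
  (* A step of size y = |p| / (|q| + 1) in a descent direction: the linear term is - y^2 (|q| + 1)
     and beats the quadratic one, at most y^2 |q|. *)
  pose e := s * (- (s * p) / (`|q| + 1)).
  have := h e.
  have s2 : s ^+ 2 = 1 by case: hs => ->; rewrite ?expr1n// sqrrN expr1n.
  set y := - (s * p) / (`|q| + 1) in e *.
  have y0 : 0 < y by rewrite divr_gt0// oppr_gt0.
  have ey : - (s * p) = y * (`|q| + 1) by rewrite /y mulfVK// gt_eqF.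
  rewrite /e exprMn s2 mul1r leNgt => /negP; apply.
  have -> : s * y * p = - (y * (y * (`|q| + 1))) by rewrite -ey; ring.
  have : y ^+ 2 * q <= y ^+ 2 * `|q| by rewrite ler_wpM2l ?sqr_ge0 ?ler_norm.
  have : 0 < y ^+ 2 by rewrite exprn_gt0.
  rewrite !expr2; lra.
apply/andP; split.
  by have := key (-1) (or_intror erefl); rewrite mulN1r oppr_ge0.
by have := key 1 (or_introl erefl); rewrite mul1r.
Qed.

(** Derivatives are known only in the open interval; this carries stationarity to the end points,
    where the Schwarz data are exchanged. *)
Lemma within_eq0 (a b : R) (f : R -> R) : a < b -> {within `[a, b], continuous f} ->
  (forall t, a < t < b -> f t = 0) -> forall t, a <= t <= b -> f t = 0.
Proof.
move=> ab cf f0 t /andP[at1 tb].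
have [_ fa fb] := (continuous_within_itvP f ab).1 cf.
have ea : f a = 0.
  have c0 : (fun=> 0 : R) @ a^'+ --> (0 : R) by exact: cvg_cst.
  apply: (cvg_unique _ fa) => //; apply: cvg_trans c0; apply: near_eq_cvg; near=> s.
  by rewrite f0//; apply/andP; split; near: s; [exact: nbhs_right_gt|exact: nbhs_right_lt].
have eb : f b = 0.
  have c0 : (fun=> 0 : R) @ b^'- --> (0 : R) by exact: cvg_cst.
  apply: (cvg_unique _ fb) => //; apply: cvg_trans c0; apply: near_eq_cvg; near=> s.
  by rewrite f0//; apply/andP; split; near: s; [exact: nbhs_left_gt|exact: nbhs_left_lt].
move: at1; rewrite le_eqVlt => /predU1P[<-//|at1].
by move: tb; rewrite le_eqVlt => /predU1P[->//|tb]; rewrite f0// at1.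
Unshelve. all: by end_near. Qed.

End QuadraticCost.

(** * First variation of the cost and pointwise stationarity *)

Section Stationarity.
Context {R : realType} {nx nu : nat}.
Variables (D : lq_data R nx nu) (a b : R).

Lemma within_dot n (x y : R -> 'cV[R]_n) :
  {within `[a, b], continuous x} -> {within `[a, b], continuous y} ->
  {within `[a, b], continuous (fun t => dot (x t) (y t))}.
Proof. by move=> cx cy; exact: within_coord 0 0 (within_mulmx (within_tr cx) cy). Qed.

Lemma stage_costE (x : 'cV[R]_nx) (u : 'cV[R]_nu) t :
  stage_cost D x u t = dot x (mxQ D t *m x) + 2 * dot u (mxH D t *m x)
                       + dot u (mxR D t *m u).
Proof.
have addE (M N : 'M[R]_1) : (M + N) 0 0 = M 0 0 + N 0 0 by rewrite mxE.
rewrite /stage_cost tr_col_mx mul_row_block mul_row_col !mulmxDl -!mulmxA !addE.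
rewrite -!/(dot _ _).
have -> : dot x ((mxH D t)^T *m u) = dot u (mxH D t *m x) by rewrite dotC dot_mulmxl trmxK.
ring.
Qed.

Hypothesis ab : a < b.
Hypotheses (cA : {within `[a, b], continuous (mxA D)})
  (cB : {within `[a, b], continuous (mxB D)}) (cQ : {within `[a, b], continuous (mxQ D)})
  (cH : {within `[a, b], continuous (mxH D)}) (cR : {within `[a, b], continuous (mxR D)}).
Hypotheses (symQ : forall t, a <= t <= b -> (mxQ D t)^T = mxQ D t)
  (symR : forall t, a <= t <= b -> (mxR D t)^T = mxR D t).

(** The bilinear form that polarises [stage_cost]. *)
Definition stage_cross (x y : 'cV[R]_nx) (u w : 'cV[R]_nu) t : R :=
  dot y (mxQ D t *m x) + dot w (mxH D t *m x) + dot u (mxH D t *m y)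
  + dot w (mxR D t *m u).

Lemma stage_cost_expansion (x y : 'cV[R]_nx) (u w : 'cV[R]_nu) t e : a <= t <= b ->
  stage_cost D (x + e *: y) (u + e *: w) t =
  stage_cost D x u t + (2 * e) * stage_cross x y u w t + e ^+ 2 * stage_cost D y w t.
Proof.
move=> tab; rewrite !stage_costE /stage_cross !mulmxDr -!scalemxAr.
rewrite !(dotDl, dotDr, dotZl, dotZr).
have -> : dot x (mxQ D t *m y) = dot y (mxQ D t *m x).
  by rewrite dotC dot_mulmxl symQ.
have -> : dot u (mxR D t *m w) = dot w (mxR D t *m u).
  by rewrite dotC dot_mulmxl symR.
by ring.
Qed.

Lemma within_stage_cost (x : R -> 'cV[R]_nx) (u : R -> 'cV[R]_nu) :
  {within `[a, b], continuous x} -> {within `[a, b], continuous u} ->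
  {within `[a, b], continuous (fun t => stage_cost D (x t) (u t) t)}.
Proof.
move=> cx cu.
have c1 := within_dot cx (within_mulmx cQ cx).
have c2 := within_dot cu (within_mulmx cH cx).
have c3 := within_dot cu (within_mulmx cR cu).
have := withinD (withinD c1 (withinD c2 c2)) c3.
by apply: within_ext => t _; rewrite stage_costE; ring.
Qed.

(** Let y be the linear response to the control variation w, with y(a) = 0. The function h = P1 +
    l^T y vanishes at a, has derivative |w|^2 by the adjoint equation, and equals the first
    variation at b, which is 0. Being monotone with equal end values, h is constant, so w = 0. *)
Lemma optimal_stationary (p r : 'cV[R]_nx) (M : 'M[R]_nx) x u l : M^T = M ->
  optimal D a b p (quadratic M r) x u ->
  adjoint D a b x u (M *m x b - r) l ->
  forall t, a <= t <= b -> mxR D t *m u t + mxH D t *m x t + (mxB D t)^T *m l t = 0.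
Proof.
move=> sM [[cu hx xa] opt] [hl lb].
have cx := hx.1; have cl := hl.1.
(* The control is varied in the direction of the residual w itself. *)
pose w t := mxR D t *m u t + mxH D t *m x t + (mxB D t)^T *m l t.
have cw : {within `[a, b], continuous w}.
  exact: withinD (withinD (within_mulmx cR cu) (within_mulmx cH cx))
    (within_mulmx (within_tr cB) cl).
have [y hy ya] := linear_ode 0 (ltW ab) cA (within_mulmx cB cw).
have cy := hy.1.
pose S1 t := stage_cross (x t) (y t) (u t) (w t) t.
have cS1 : {within `[a, b], continuous S1}.
  exact: withinD (withinD (withinD (within_dot cy (within_mulmx cQ cx))
    (within_dot cw (within_mulmx cH cx))) (within_dot cu (within_mulmx cH cy)))
    (within_dot cw (within_mulmx cR cu)).
have cS0 := within_stage_cost cx cu.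
have cS2 := within_stage_cost cy cw.
have h0 := C1on_Rintegral (ltW ab) cS0.
have h1 := C1on_Rintegral (ltW ab) cS1.
have h2 := C1on_Rintegral (ltW ab) cS2.
set P0 := (fun t => _) in h0; set P1 := (fun t => _) in h1; set P2 := (fun t => _) in h2.
have P0a : P0 a = 0 by rewrite /P0 set_itv1 Rintegral_set1.
have P1a : P1 a = 0 by rewrite /P1 set_itv1 Rintegral_set1.
have P2a : P2 a = 0 by rewrite /P2 set_itv1 Rintegral_set1.
(* The terminal contribution is l(b)^T y(b) because l(b) is the gradient M x(b) - r of the terminal
   cost. *)
have variation e : 0 <= e * (P1 b + dot (l b) (y b)) +
    e ^+ 2 * (2^-1 * P2 b + 2^-1 * dot (y b) (M *m y b)).
  pose xe t := x t + e *: y t; pose ue t := u t + e *: w t.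
  have cZ n (f : R -> 'cV[R]_n) : {within `[a, b], continuous f} ->
      {within `[a, b], continuous (fun t => e *: f t)}.
    by move=> cf; have := within_mulmx cf (@within_cst _ _ a b (e%:M : 'M[R]_1));
      apply: within_ext => t _; rewrite mul_mx_scalar.
  have cue : {within `[a, b], continuous ue} by exact: withinD cu (cZ _ _ cw).
  have hye : C1on a b (fun t => e *: y t) (fun t => e *: (mxA D t *m y t + mxB D t *m w t)).
    have hye := C1on_mulmxr (e%:M : 'M[R]_1) hy.
    apply: C1on_ext (C1on_eq _ hye) => t _; by rewrite mul_mx_scalar.
  have feas : feasible D a b p xe ue.
    split=> //; last by rewrite /xe xa ya scaler0 addr0.
    apply: C1on_eq (C1onD hx hye) => t _.
    by rewrite /xe /ue (mulmxDr _ (x t)) (mulmxDr _ (u t)) -!scalemxAr scalerDr addrACA.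
  have := opt _ _ feas; rewrite /cost.
  have -> : \int[lebesgue_measure]_(t in `[a, b]) stage_cost D (xe t) (ue t) t =
      P0 b + (2 * e) * P1 b + e ^+ 2 * P2 b.
    (* The perturbed running cost is evaluated through an explicit antiderivative. *)
    have hP := C1onD (C1onD h0 (C1onZ (2 * e) h1)) (C1onZ (e ^+ 2) h2).
    have eP : C1on a b (fun t => P0 t + 2 * e * P1 t + e ^+ 2 * P2 t)
        (fun t => stage_cost D (xe t) (ue t) t).
      apply: C1on_eq hP => t /andP[at1 tb].
      by rewrite stage_cost_expansion// !ltW.
    rewrite (C1on_FTC ab eP); first by rewrite P0a P1a P2a; ring.
    by apply: within_stage_cost => //; exact: withinD cx hye.1.
  rewrite quadratic_expansion// -lb -/(P0 b).
  by lra.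
have stat := linear_term_eq0 variation.
pose h t := P1 t + dot (l t) (y t).
have hh : C1on a b h (fun t => dot (w t) (w t)).
  apply: C1on_eq (C1onD h1 (C1on_dot hl hy)) => t /andP[at1 tb].
  have tab : a <= t <= b by rewrite !ltW.
  have e1 : dot (w t) (w t) = dot (w t) (mxR D t *m u t) + dot (w t) (mxH D t *m x t)
      + dot (w t) ((mxB D t)^T *m l t) by rewrite {2}/w !dotDr.
  rewrite e1 /S1 /stage_cross !(dotBl, dotNl, dotDr) !dot_mulmxl trmxK symQ//.
  have -> : dot (l t) (mxB D t *m w t) = dot (w t) ((mxB D t)^T *m l t).
    by rewrite dotC dot_mulmxl.
  have -> : dot (y t) (mxQ D t *m x t) = dot (x t) (mxQ D t *m y t).
    by rewrite dotC dot_mulmxl symQ.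
  have -> : dot (l t) (mxA D t *m y t) = dot (y t) ((mxA D t)^T *m l t).
    by rewrite dotC dot_mulmxl.
  by rewrite trmxK; ring.
have ha : h a = 0 by rewrite /h P1a ya dot0r addr0.
have hb : h b = 0 by [].
have w0 t : a < t < b -> dot (w t) (w t) = 0.
  move=> tab; have c0 := C1on_cst a b (0 : R).
  have hz s : a <= s <= b -> h s = 0.
    move=> /andP[as1 sb].
    have := C1on_le as1 (C1on_sub (lexx a) sb c0) (C1on_sub (lexx a) sb hh) (fun t _ => dot_ge0 _).
    have := C1on_le sb (C1on_sub as1 (lexx b) c0) (C1on_sub as1 (lexx b) hh) (fun t _ => dot_ge0 _).
    by rewrite ha hb; lra.
  have [_ d0] := C1on_ext (fun s hs => esym (hz s hs)) c0.
  have [_ e1] := d0 t tab; have [_ e2] := hh.2 t tab.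
  by rewrite -e2 e1.
by move=> t tab; apply: dot_eq0; apply: (within_eq0 ab (within_dot cw cw) w0 tab).
Qed.

End Stationarity.

(** * Bounds for the reduced problem *)

Ltac nneg := repeat first
  [ assumption | by apply: ltW; assumption | exact: expR_ge0 | exact: enorm_ge0
  | exact: dot_ge0 | exact: ler01 | exact: ler0n | apply: exprn_ge0
  | rewrite invr_ge0 | apply: mulr_ge0 | apply: addr_ge0 ].

Section Growth.
Context {R : realType} {n : nat}.

(** Gronwall in both directions: |y|^2 has derivative between - 2 k |y|^2 and 2 k |y|^2, so it is
    monotone after multiplication by the matching exponential. *)
Lemma linear_growth (s t k : R) (A : R -> 'M[R]_n) (y : R -> 'cV[R]_n) : s <= t ->
  C1on s t y (fun r => A r *m y r) -> (forall r, s < r < t -> mxbound (A r) k) ->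
  enorm (y t) <= expR (k * (t - s)) * enorm (y s) /\
  enorm (y s) <= expR (k * (t - s)) * enorm (y t).
Proof.
move=> st hy hA.
have hN := C1on_dot hy hy.
have e2 : expR (2 * k * (t - s)) = expR (k * (t - s)) ^+ 2.
  by rewrite -expRM_natl; congr expR; ring.
have e2' : expR (- (2 * k) * (t - s)) = (expR (k * (t - s)) ^+ 2)^-1.
  by rewrite -e2 -expRN; congr expR; ring.
have c0 := C1on_cst s t (0 : R).
split; rewrite enorm_le ?mulr_ge0 ?expR_ge0 ?enorm_ge0// exprMn enorm_sqr.
  have le r : s < r < t ->
      - (2 * k) * expR (- (2 * k) * (r - s)) * dot (y r) (y r) +
      expR (- (2 * k) * (r - s)) * (dot (A r *m y r) (y r) + dot (y r) (A r *m y r)) <= 0.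
    move=> srt; rewrite mulrAC mulrC -mulrDr pmulr_rle0 ?expR_gt0//.
    have := dot_mxbound (y r) (hA r srt); rewrite (dotC (A r *m _)); lra.
  have := C1on_le st (C1onM (C1on_expR s t (- (2 * k)) s) hN) c0 le.
  rewrite !subrr mulr0 expR0 mul1r subr_le0 e2' ler_pdivrMl//.
  by rewrite exprn_gt0 ?expR_gt0.
have le r : s < r < t -> 0 <=
    2 * k * expR (2 * k * (r - s)) * dot (y r) (y r) +
    expR (2 * k * (r - s)) * (dot (A r *m y r) (y r) + dot (y r) (A r *m y r)).
  move=> srt; rewrite mulrAC mulrC -mulrDr pmulr_rge0 ?expR_gt0//.
  have := dot_mxbound (y r) (mxboundN (hA r srt)).
  rewrite mulNmx dotNr (dotC (A r *m _)); lra.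
have := C1on_le st c0 (C1onM (C1on_expR s t (2 * k) s) hN) le.
by rewrite !subrr mulr0 expR0 mul1r subr_ge0 e2.
Qed.

End Growth.

Section Reduced.
Context {R : realType} {nx nu : nat}.
Variable D : lq_data R nx nu.

Definition reducedA t := mxA D t - mxB D t *m invmx (mxR D t) *m mxH D t.
Definition reducedG t := mxB D t *m invmx (mxR D t) *m (mxB D t)^T.
Definition reducedQ t := mxQ D t - (mxH D t)^T *m invmx (mxR D t) *m mxH D t.

Variables (C : lq_constants R) (T : R) (Phi : R -> R -> 'M[R]_nx).
Hypotheses (hsym : symmetric_data D T) (hbnd : bounded_data D C T)
  (hPhi : evolution_operator (mxA D) T Phi)
  (hucc : uniformly_completely_controllable D C T Phi)
  (hcoe : coercive D C T).

Let gR0 : 0 < gamR C. Proof. by case: hcoe. Qed.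
Let gQ0 : 0 < gamQ C. Proof. by case: hcoe. Qed.
Let lA0 : 0 < lamA C. Proof. by case: hbnd => [[]]. Qed.
Let lB0 : 0 < lamB C. Proof. by case: hbnd => [[]]. Qed.
Let lQ0 : 0 < lamQ C. Proof. by case: hbnd => [[]]. Qed.
Let lH0 : 0 < lamH C. Proof. by case: hbnd => [[]]. Qed.
Let lR0 : 0 < lamR C. Proof. by case: hbnd => [[]]. Qed.
Let s0 : 0 < sigma C. Proof. by case: hucc => /andP[]. Qed.
Let T0 : 0 < T. Proof. by case: hucc => /andP[h1 h2] _ _; exact: lt_trans h2. Qed.

Lemma kappa_ge : lamA C <= kappa C.
Proof. by rewrite /kappa lerDl !mulr_ge0// ?invr_ge0 ltW. Qed.

Lemma kappa_gt0 : 0 < kappa C.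
Proof. exact: lt_le_trans kappa_ge. Qed.

Lemma A_bound (t : R) : 0 <= t <= T -> mxbound (mxA D t) (lamA C).
Proof. by case: hbnd => _ _ [h _ _ _ _]; exact: mxbound_supnorm. Qed.
Lemma B_bound (t : R) : 0 <= t <= T -> mxbound (mxB D t) (lamB C).
Proof. by case: hbnd => _ _ [_ h _ _ _]; exact: mxbound_supnorm. Qed.
Lemma Q_bound (t : R) : 0 <= t <= T -> mxbound (mxQ D t) (lamQ C).
Proof. by case: hbnd => _ _ [_ _ h _ _]; exact: mxbound_supnorm. Qed.
Lemma H_bound (t : R) : 0 <= t <= T -> mxbound (mxH D t) (lamH C).
Proof. by case: hbnd => _ _ [_ _ _ h _]; exact: mxbound_supnorm. Qed.
Lemma R_bound (t : R) : 0 <= t <= T -> mxbound (mxR D t) (lamR C).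
Proof. by case: hbnd => _ _ [_ _ _ _ h]; exact: mxbound_supnorm. Qed.

Lemma R_coercive (t : R) : 0 <= t <= T -> forall v, gamR C * dot v v <= dot v (mxR D t *m v).
Proof.
move=> tT v; case: hcoe => _ _ /(_ t tT)[/loewner_leP/(_ v) + _] _ _.
by rewrite dot_scalar_mx.
Qed.

Lemma R_inv (t : R) : 0 <= t <= T ->
  mxR D t \in unitmx /\ mxbound (invmx (mxR D t)) (gamR C)^-1.
Proof. by move=> tT; exact: coercive_inv (R_coercive tT). Qed.

Lemma Rinv_sym (t : R) : 0 <= t <= T -> (invmx (mxR D t))^T = invmx (mxR D t).
Proof. by move=> tT; rewrite trmx_inv; case: hsym => _ -> //. Qed.

Lemma Rinv_ge0 (t : R) : 0 <= t <= T -> forall v, 0 <= dot v (invmx (mxR D t) *m v).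
Proof.
move=> tT v; have [u _] := R_inv tT.
have := R_coercive tT (invmx (mxR D t) *m v).
rewrite mulmxA mulmxV// mul1mx (dotC _ v); apply: le_trans.
by rewrite mulr_ge0 ?dot_ge0// ltW.
Qed.

Lemma reducedA_bound (t : R) : 0 <= t <= T -> mxbound (reducedA t) (kappa C).
Proof.
move=> tT; apply: mxboundD; first exact: A_bound.
apply: mxboundN.
have -> : lamB C * lamH C / gamR C = lamB C / gamR C * lamH C by rewrite mulrAC.
have [_ Ri] := R_inv tT.
apply: mxboundM; first by rewrite divr_ge0// ltW.
  by apply: mxboundM => //; [rewrite ltW|exact: B_bound].
exact: H_bound.
Qed.

Lemma reducedG_bound (t : R) : 0 <= t <= T -> mxbound (reducedG t) (lamB C ^+ 2 / gamR C).
Proof.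
move=> tT; have -> : lamB C ^+ 2 / gamR C = lamB C / gamR C * lamB C by rewrite expr2 mulrAC.
have [_ Ri] := R_inv tT.
apply: mxboundM; first by rewrite divr_ge0// ltW.
  by apply: mxboundM => //; [rewrite ltW|exact: B_bound].
by apply: mxbound_tr; [rewrite ltW|exact: B_bound].
Qed.

Lemma reducedG_sym (t : R) : 0 <= t <= T -> (reducedG t)^T = reducedG t.
Proof. by move=> tT; rewrite /reducedG !trmx_mul trmxK Rinv_sym// mulmxA. Qed.

Lemma reducedQ_sym (t : R) : 0 <= t <= T -> (reducedQ t)^T = reducedQ t.
Proof.
move=> tT; rewrite /reducedQ linearB/= !trmx_mul trmxK Rinv_sym// mulmxA.
by case: hsym => ->.
Qed.

Lemma dot_reducedG t v : dot v (reducedG t *m v) =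
  dot ((mxB D t)^T *m v) (invmx (mxR D t) *m ((mxB D t)^T *m v)).
Proof. by rewrite dot_mulmxl trmxK !mulmxA. Qed.

Lemma reducedG_ge0 (t : R) : 0 <= t <= T -> forall v, 0 <= dot v (reducedG t *m v).
Proof. by move=> tT v; rewrite dot_reducedG Rinv_ge0. Qed.

Lemma reducedQ_ge (t : R) : 0 <= t <= T -> forall v, gamQ C * dot v v <= dot v (reducedQ t *m v).
Proof.
move=> tT v; case: hcoe => _ _ /(_ t tT)[_ /loewner_leP/(_ v)] + _ _.
by rewrite dot_scalar_mx.
Qed.

Lemma Q_ge (t : R) : 0 <= t <= T -> forall v, gamQ C * dot v v <= dot v (mxQ D t *m v).
Proof.
move=> tT v; apply: le_trans (reducedQ_ge tT v) _.
rewrite /reducedQ mulmxBl dotBr lerBlDr lerDl -!mulmxA.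
by have := Rinv_ge0 tT (mxH D t *m v); rewrite dot_mulmxl.
Qed.

Lemma Q_inv (t : R) : 0 <= t <= T ->
  mxQ D t \in unitmx /\ mxbound (invmx (mxQ D t)) (gamQ C)^-1.
Proof. by move=> tT; exact: coercive_inv (Q_ge tT). Qed.

Lemma data_continuous : [/\ {within `[0, T], continuous (mxA D)},
          {within `[0, T], continuous (mxB D)},
          {within `[0, T], continuous (mxQ D)},
          {within `[0, T], continuous (mxH D)}
        & {within `[0, T], continuous (mxR D)}].
Proof. by case: hbnd. Qed.

Lemma reduced_continuous : [/\ {within `[0, T], continuous reducedA},
  {within `[0, T], continuous reducedG} & {within `[0, T], continuous reducedQ}].
Proof.
have [cA cB cQ cH cR] := data_continuous.
have cRi : {within `[0, T], continuous (fun t => invmx (mxR D t))}.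
  by apply: within_invmx => // t tT; case: (R_inv tT).
split.
- exact: withinB cA (within_mulmx (within_mulmx cB cRi) cH).
- exact: within_mulmx (within_mulmx cB cRi) (within_tr cB).
- exact: withinB cQ (within_mulmx (within_mulmx (within_tr cH) cRi) cH).
Qed.

(** Completing the square in the control. *)
Lemma stage_cost_reduced y v (t : R) : 0 <= t <= T ->
  let w := v + invmx (mxR D t) *m (mxH D t *m y) in
  stage_cost D y v t = dot y (reducedQ t *m y) + dot w (mxR D t *m w).
Proof.
move=> tT w; have [u _] := R_inv tT.
have sR : (mxR D t)^T = mxR D t by case: hsym => _ ->.
rewrite stage_costE /reducedQ mulmxBl dotBr -!mulmxA.
set h := mxH D t *m y.
have -> : dot y ((mxH D t)^T *m (invmx (mxR D t) *m h)) = dot h (invmx (mxR D t) *m h).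
  by rewrite dot_mulmxl.
have e : mxR D t *m w = mxR D t *m v + h by rewrite mulmxDr mulmxA mulmxV// mul1mx.
rewrite e /w -/h !dotDl !dotDr (dotC (invmx _ *m h) h).
have -> : dot (invmx (mxR D t) *m h) (mxR D t *m v) = dot v h.
  by rewrite dotC dot_mulmxl sR mulmxA mulmxV// mul1mx.
ring.
Qed.

(** Young's inequality weighted by gamR splits the cross term; its control part gamR |v|^2 is at
    most v^T R v <= lamR |v|^2, hence the coefficient 2 lamR. *)
Lemma stage_cost_le y v (t : R) : 0 <= t <= T ->
  stage_cost D y v t <= (lamQ C + lamH C ^+ 2 / gamR C) * dot y y + 2 * lamR C * dot v v.
Proof.
move=> tT; rewrite stage_costE.
have h1 := dot_mxbound y (Q_bound tT).
have h2 := dot_mxbound v (R_bound tT).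
have h3 := R_coercive tT v.
have h4 : 2 * dot v (mxH D t *m y) <= lamH C ^+ 2 / gamR C * dot y y + gamR C * dot v v.
  have c := cauchy_schwarz v (mxH D t *m y).
  have hb := H_bound tT y.
  have : dot v (mxH D t *m y) <= enorm v * (lamH C * enorm y).
    by rewrite (le_trans c)// ler_wpM2l ?enorm_ge0.
  rewrite -!enorm_sqr; set p := enorm v; set q := enorm y => h.
  have sq : 0 <= (lamH C * q - gamR C * p) ^+ 2 / gamR C.
    by rewrite divr_ge0 ?sqr_ge0// ltW.
  have e : (lamH C * q - gamR C * p) ^+ 2 / gamR C =
      lamH C ^+ 2 / gamR C * q ^+ 2 + gamR C * p ^+ 2 - 2 * (p * (lamH C * q)).
    by field; rewrite gt_eqF.
  lra.
lra.
Qed.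

(* V - 2 l^T y is, up to the stage cost of (y, v), minus a sum of two squares. *)
Lemma comparison (a b : R) (x l : R -> 'cV[R]_nx) (t s : R) (y : R -> 'cV[R]_nx)
    (v : R -> 'cV[R]_nu) (N N' : R -> R) :
  0 <= a -> b <= T -> a <= t -> t <= s -> s <= b ->
  hamiltonian a b reducedA reducedG reducedQ x l ->
  C1on t s y (fun r => mxA D r *m y r + mxB D r *m v r) ->
  C1on t s N N' -> (forall r, t < r < s -> stage_cost D (y r) (v r) r <= N' r) ->
  2 * dot (l t) (y t) + dot (x s) (l s) - 2 * dot (l s) (y s) <=
  dot (x t) (l t) + (N s - N t).
Proof.
move=> a0 bT at1 ts sb hxl hy hN le.
have hV := C1on_sub at1 sb (C1on_value hxl).
have hly := C1onZ 2 (C1on_dot (C1on_sub at1 sb hxl.2) hy).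
have := C1on_le ts (C1onB hV hly) hN.
suff h : forall r, t < r < s ->
    - dot (l r) (reducedG r *m l r) - dot (x r) (reducedQ r *m x r) -
    2 * (dot (- ((reducedA r)^T *m l r) - reducedQ r *m x r) (y r) +
       dot (l r) (mxA D r *m y r + mxB D r *m v r)) <= N' r.
  by move=> /(_ h); lra.
move=> r trs; apply: le_trans (le r trs).
have rT : 0 <= r <= T.
  case/andP: trs => h1 h2; apply/andP; split.
    by rewrite (le_trans a0)// (le_trans at1)// ltW.
  by rewrite (le_trans (ltW h2))// (le_trans sb).
have [u _] := R_inv rT.
have sR : (mxR D r)^T = mxR D r by case: hsym => _ ->.
rewrite stage_cost_reduced//=.
have [w wE] : {w | w = v r + invmx (mxR D r) *m (mxH D r *m y r)} by eexists.
rewrite -wE.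
(* The two squares are (x - y)^T Q' (x - y) and the R^-1 form of B^T l + R w, where w is the control
   shifted by R^-1 H y. *)
have q := reducedQ_ge rT (x r - y r).
have {}q : 0 <= dot (x r - y r) (reducedQ r *m (x r - y r)).
  by apply: le_trans q; rewrite mulr_ge0 ?dot_ge0// ltW.
have g := Rinv_ge0 rT ((mxB D r)^T *m l r + mxR D r *m w).
have eQ : dot (y r) (reducedQ r *m x r) = dot (x r) (reducedQ r *m y r).
  by rewrite dotC dot_mulmxl reducedQ_sym.
rewrite mulmxBr dotBl !dotBr eQ in q.
rewrite mulmxDr (mulmxA (invmx _) (mxR D r)) mulVmx// mul1mx dotDl !dotDr -dot_reducedG in g.
have e1 : dot (mxR D r *m w) (invmx (mxR D r) *m ((mxB D r)^T *m l r)) =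
    dot (l r) (mxB D r *m w).
  by rewrite dot_mulmxl sR mulmxA mulmxV// mul1mx dotC dot_mulmxl trmxK.
have e2 : dot ((mxB D r)^T *m l r) w = dot (l r) (mxB D r *m w).
  by rewrite dot_mulmxl trmxK.
have e3 : dot (mxR D r *m w) w = dot w (mxR D r *m w) by rewrite dotC.
have e4 : dot (l r) (mxB D r *m w) = dot (l r) (mxB D r *m v r) +
    dot (l r) (mxA D r *m y r) - dot (l r) (reducedA r *m y r).
  by rewrite wE /reducedA mulmxDr mulmxBl !mulmxA dotDr dotBr; ring.
rewrite e1 e2 e3 e4 in g.
rewrite dotBl dotNl dot_mulmxl trmxK dotDr (dotC (reducedQ r *m _)) eQ; lra.
Qed.

(** [evolution_operator] gives regularity of Phi t s in t only, while the Gramian integrates over s.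
    The factorisation supplies continuity in s. *)
Lemma evolution_factor : exists X Y : R -> 'M[R]_nx,
  [/\ C1on 0 T X (fun t => mxA D t *m X t), {within `[0, T], continuous Y},
      forall t, 0 <= t <= T -> Y t *m X t = 1%:M
    & forall t s, 0 <= t <= T -> 0 <= s <= T -> Phi t s = X t *m Y s].
Proof.
have [cA _ _ _ _] := data_continuous.
have c0 := @within_cst _ _ 0 T (0 : 'M[R]_nx).
have [X hX X0] := linear_ode (1%:M : 'M[R]_nx) (ltW T0) cA c0.
have {}hX : C1on 0 T X (fun t => mxA D t *m X t) by apply: C1on_eq hX => t _; rewrite addr0.
have [Z hZ Z0] := linear_ode (1%:M : 'M[R]_nx) (ltW T0) (withinN (within_tr cA)) c0.
pose Y t := (Z t)^T.
have hY : C1on 0 T Y (fun t => - (Y t *m mxA D t)).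
  by apply: C1on_eq (C1on_tr hZ) => t _; rewrite addr0 mulNmx linearN/= trmx_mul trmxK.
(* Y solves the adjoint equation, so Y W is constant for every solution W, in particular for X and
   for each Phi t s. *)
have cst p (W : R -> 'M[R]_(nx, p)) : C1on 0 T W (fun t => mxA D t *m W t) ->
    forall s t, 0 <= s <= T -> 0 <= t <= T -> Y s *m W s = Y t *m W t.
  move=> hW; apply: C1on_const.
  by apply: C1on_eq (C1on_mulmx hY hW) => t _; rewrite mulNmx mulmxA addNr.
have z0 : 0 <= (0 : R) <= T by rewrite lexx ltW.
have YX t : 0 <= t <= T -> Y t *m X t = 1%:M.
  by move=> tT; rewrite (cst _ _ hX t 0)// X0 mulmx1 /Y Z0 trmx1.
exists X, Y; split => //; first exact: hY.1.
move=> t s tT sT; have [Pss hP] := hPhi sT.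
have XY := mulmx1C (YX t tT).
by rewrite -[LHS]mul1mx -XY -mulmxA (cst _ _ hP t s)// Pss mulmx1.
Qed.

Lemma evolution_growth (t s : R) : 0 <= t <= s -> s <= T ->
  mxbound (Phi s t) (expR (kappa C * (s - t))) /\
  mxbound (Phi t s) (expR (kappa C * (s - t))).
Proof.
move=> /andP[t0 ts] sT.
have tT : 0 <= t <= T by rewrite t0 (le_trans ts).
have sT' : 0 <= s <= T by rewrite sT (le_trans t0).
have hA r : t < r < s -> mxbound (mxA D r) (kappa C).
  move=> /andP[h1 h2]; apply: mxbound_le kappa_ge _; apply: A_bound.
  by rewrite (le_trans t0 (ltW h1)) (le_trans (ltW h2)).
have g r y (rT : 0 <= r <= T) :
    enorm (Phi s r *m y) <= expR (kappa C * (s - t)) * enorm (Phi t r *m y) /\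
    enorm (Phi t r *m y) <= expR (kappa C * (s - t)) * enorm (Phi s r *m y).
  have hy := C1on_sub t0 sT (C1on_mulmxr y (hPhi rT).2).
  exact: linear_growth ts (C1on_eq (fun _ _ => esym (mulmxA _ _ _)) hy) hA.
split=> y.
  by have [+ _] := g t y tT; rewrite (hPhi tT).1 mul1mx.
by have [_] := g s y sT'; rewrite (hPhi sT').1 mul1mx.
Qed.

(** Bounds the stage cost of the steered trajectory from y, divided by e^(2 kappa (r - t)) |y|^2.
    Integration over a window of length sigma gives the first entry of the maximum in [c1]. *)
Definition steering_weight : R :=
  (lamQ C + lamH C ^+ 2 / gamR C) * (1 + alpha1' C / alpha0' C) ^+ 2
  + lamR C * lamB C ^+ 2 / alpha0' C ^+ 2.

Let a0_gt0 : 0 < alpha0 C. Proof. by case: hucc => _ []. Qed.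
Let a1_gt0 : 0 < alpha1 C. Proof. by case: hucc => _ []. Qed.

Let k0 : 0 < kappa C := kappa_gt0.

Lemma expR_kappa_ge1 : 1 <= expR (2 * kappa C * sigma C).
Proof. by rewrite -expR0 ler_expR !mulr_ge0// ltW. Qed.

(** Steering uses the Gramian of (A, B) itself, whose inverse is bounded by 1 / alpha0. This
    converts to the constant in [c1]; the spare factor 2 pays for the 2 lamR of [stage_cost_le]. *)
Lemma alpha0'_inv : 2 / alpha0 C <= (alpha0' C)^-1.
Proof.
rewrite /alpha0' invrK lerDl mulr_ge0//; first by nneg.
by rewrite subr_ge0 -expR0 ler_expR !mulr_ge0// ltW.
Qed.

Lemma alpha0'_gt0 : 0 < alpha0' C.
Proof. by rewrite -invr_gt0; apply: lt_le_trans alpha0'_inv; rewrite divr_gt0. Qed.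

Lemma alpha1'_ge0 : 0 <= alpha1' C.
Proof.
have h : 0 <= expR (2 * kappa C * sigma C) - 1 by rewrite subr_ge0 expR_kappa_ge1.
by rewrite /alpha1'; nneg.
Qed.

Lemma steering_weight_ge0 : 0 <= steering_weight.
Proof.
have h1 := ltW alpha0'_gt0; have h2 := alpha1'_ge0.
by rewrite /steering_weight; nneg.
Qed.

Lemma c1_ge_steering :
  steering_weight / (2 * kappa C) * expR (2 * kappa C * sigma C) <= c1 C.
Proof.
by rewrite /c1 ler_wpM2r ?expR_ge0// le_max div1r mulrC lexx.
Qed.

Lemma c1_ge_free :
  lamQ C * (1 + 1 / (2 * kappa C)) * expR (2 * kappa C * sigma C) <= c1 C.
Proof.
rewrite /c1 ler_wpM2r ?expR_ge0// le_max; apply/orP; right.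
by rewrite ler_wpM2r ?lerDl; nneg.
Qed.

Lemma c1_gt0 : 0 < c1 C.
Proof.
apply: lt_le_trans c1_ge_free.
rewrite !mulr_gt0 ?expR_gt0 ?addr_gt0 ?divr_gt0 ?mulr_gt0//.
Qed.

(** * Upper bound of the value through comparison trajectories *)

Section ValueUpper.
Variables (a b : R) (x l : R -> 'cV[R]_nx) (K : 'M[R]_nx).
Hypotheses (a_ge0 : 0 <= a) (bT : b <= T)
  (hxl : hamiltonian a b reducedA reducedG reducedQ x l) (lb : l b = K *m x b)
  (symK : K^T = K) (K_ge0 : forall y, 0 <= dot y (K *m y))
  (K_le : forall y, dot y (K *m y) <= lamQ C * dot y y).

Lemma value_nonneg t : a <= t <= b -> 0 <= dot (x t) (l t).
Proof.
move=> /andP[at1 tb].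
have c0 := C1on_cst t b (0 : R).
have le r : t < r < b ->
    - dot (l r) (reducedG r *m l r) - dot (x r) (reducedQ r *m x r) <= 0.
  move=> /andP[h1 h2]; have rT : 0 <= r <= T.
    by rewrite (le_trans a_ge0 (le_trans at1 (ltW h1))) (le_trans (ltW h2)).
  have := reducedG_ge0 rT (l r); have := reducedQ_ge rT (x r).
  have : 0 <= gamQ C * dot (x r) (x r) by rewrite mulr_ge0 ?dot_ge0// ltW.
  lra.
have := C1on_le tb (C1on_sub at1 (lexx b) (C1on_value hxl)) c0 le.
have := K_ge0 (x b); rewrite -lb; lra.
Qed.

(** Too little time may be left to steer, so the comparison trajectory is uncontrolled. Its running
    and terminal costs give the summands 1 / (2 kappa) and 1 in the second entry of [c1]. *)
Lemma value_upper_short t y : a <= t <= b -> b <= t + sigma C ->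
  2 * dot (l t) y <= dot (x t) (l t) + c1 C * dot y y.
Proof.
move=> /andP[at1 tb] bs.
have t0 : 0 <= t by exact: le_trans at1.
have tT : 0 <= t <= T by rewrite t0 (le_trans tb).
pose z r := Phi r t *m y.
have hz : C1on t b z (fun r => mxA D r *m z r + mxB D r *m (0 : 'cV[R]_nu)).
  apply: C1on_eq (C1on_sub t0 bT (C1on_mulmxr y (hPhi tT).2)) => r _.
  by rewrite mulmx0 addr0 mulmxA.
pose w := lamQ C * dot y y.
have hN := C1onZ (w / (2 * kappa C)) (C1on_expR t b (2 * kappa C) t).
have zle r : t <= r <= b -> dot (z r) (z r) <= expR (2 * kappa C * (r - t)) * dot y y.
  move=> /andP[tr rb]; have tr' : 0 <= t <= r by rewrite t0.
  have [g _] := evolution_growth tr' (le_trans rb bT).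
  have := g y; rewrite enorm_le ?mulr_ge0 ?expR_ge0 ?enorm_ge0// exprMn enorm_sqr.
  by rewrite -expRM_natl; congr (_ <= expR _ * _); ring.
have le r : t < r < b -> stage_cost D (z r) (0 : 'cV[R]_nu) r <=
    w / (2 * kappa C) * (2 * kappa C * expR (2 * kappa C * (r - t))).
  move=> /andP[h1 h2]; have rT : 0 <= r <= T.
    by rewrite (le_trans t0 (ltW h1)) (le_trans (ltW h2)).
  rewrite stage_costE mulmx0 !dot0l mulr0 !addr0.
  apply: le_trans (dot_mxbound _ (Q_bound rT)) _.
  rewrite mulrA mulfVK ?gt_eqF ?mulr_gt0// /w mulrAC -mulrA ler_wpM2l ?(ltW lQ0)//.
  by apply: zle; rewrite !ltW.
have := comparison a_ge0 bT at1 tb (lexx b) hxl hz hN le.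
rewrite {1}/z (hPhi tT).1 mul1mx subrr mulr0 expR0 mulr1.
(* Gives x(b)^T l(b) - 2 l(b)^T z(b) >= - z(b)^T K z(b), so only the terminal cost of z remains. *)
have Kxz := K_ge0 (x b - z b).
rewrite mulmxBr dotBl !dotBr -lb in Kxz.
have e : dot (z b) (l b) = dot (l b) (z b) by rewrite dotC.
have e2 : dot (x b) (K *m z b) = dot (l b) (z b) by rewrite lb dot_mulmxl symK.
rewrite e e2 in Kxz.
have Kz := K_le (z b).
have zb : lamQ C * dot (z b) (z b) <= w * expR (2 * kappa C * sigma C).
  rewrite /w -mulrA ler_wpM2l ?(ltW lQ0)//.
  apply: le_trans (zle b _) _; first by rewrite tb lexx.
  rewrite mulrC ler_wpM2l ?dot_ge0// ler_expR ler_wpM2l ?mulr_ge0 ?(ltW k0)//.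
  by rewrite lerBlDl.
have w0 : 0 <= w by rewrite mulr_ge0 ?dot_ge0// ltW.
have Nt : 0 <= w / (2 * kappa C) by nneg.
have Nb : w / (2 * kappa C) * expR (2 * kappa C * (b - t)) <=
    w / (2 * kappa C) * expR (2 * kappa C * sigma C).
  rewrite ler_wpM2l//.
  by rewrite ler_expR ler_wpM2l ?mulr_ge0 ?(ltW k0)// lerBlDl.
have c1w : w / (2 * kappa C) * expR (2 * kappa C * sigma C) +
    w * expR (2 * kappa C * sigma C) <= c1 C * dot y y.
  rewrite (_ : _ + _ = lamQ C * (1 + 1 / (2 * kappa C)) * expR (2 * kappa C * sigma C) * dot y y).
    by rewrite ler_wpM2r ?dot_ge0// c1_ge_free.
  by rewrite /w; field; rewrite gt_eqF.
lra.
Qed.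

(** The controllability window fits into the subdomain, so y can be steered to 0 at some t1 <= b.
    The terms in z then vanish at t1, and the remaining V(t1) has the right sign. *)
Lemma value_upper_long t y : a <= t <= b -> t + sigma C <= b ->
  2 * dot (l t) y <= dot (x t) (l t) + c1 C * dot y y.
Proof.
move=> /andP[at1 tb] sb.
have t0 : 0 <= t by exact: le_trans at1.
have [_ _ /(_ t)] := hucc; rewrite t0 lerBrDr (le_trans sb bT) => /(_ isT)[t1 []].
set W := gramian Phi (mxB D) t t1 => /andP[tt1 t1s] /loewner_leP Wge _ _ _.
have t1b : t1 <= b by exact: le_trans sb.
have t1T := le_trans t1b bT.
have tT : 0 <= t <= T by rewrite t0 (le_trans tb).
have {}Wge v : alpha0 C * dot v v <= dot v (W *m v) by rewrite -dot_scalar_mx.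
have [Wu Winv] := coercive_inv a0_gt0 Wge.
pose eta := invmx W *m y.
have etale : enorm eta <= (alpha0 C)^-1 * enorm y by exact: Winv.
have [X [Y [hX cY YX PhiE]]] := evolution_factor.
have [_ cB _ _ _] := data_continuous.
have inT r : t <= r <= t1 -> 0 <= r <= T.
  by move=> /andP[h1 h2]; rewrite (le_trans t0 h1) (le_trans h2).
have ltW2 r : t < r < t1 -> t <= r <= t1 by case/andP => *; rewrite !ltW.
have cB' := within_sub t0 t1T cB.
have cPhi : {within `[t, t1], continuous (Phi t)}.
  have := within_mulmx (@within_cst _ _ t t1 (X t)) (within_sub t0 t1T cY).
  by apply: within_ext => r /inT rT; rewrite PhiE.
have hI := C1on_mxintegral tt1 (within_mulmx (within_mulmx (within_mulmx cPhi cB')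
   (within_tr cB')) (within_tr cPhi)).
set I := (fun r => mxintegral t r _) in hI.
have It : I t = 0 by exact: mxintegral0.
have It1 : I t1 = W by [].
(* The minimum-energy control, steering y to 0 at time t1. *)
pose v r : 'cV[R]_nu := - ((mxB D r)^T *m ((Phi t r)^T *m eta)).
(* Variation of constants, with [I] the Gramian accumulated up to r: I(t) = 0 gives z(t) = y, and
   I(t1) = W with eta = W^-1 y gives z(t1) = 0. *)
pose z r := Phi r t *m (y - I r *m eta).
have hz : C1on t t1 z (fun r => mxA D r *m z r + mxB D r *m v r).
  have he := C1onB (C1on_cst t t1 y) (C1on_mulmxr eta hI).
  have := C1on_mulmx (C1on_sub t0 t1T (hPhi tT).2) he.
  apply: C1on_eq => r rI; have rT := inT r (ltW2 _ rI).
  rewrite /z mulmxA sub0r; congr (_ + _).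
  have PP : Phi r t *m Phi t r = 1%:M.
    by rewrite !PhiE// -mulmxA (mulmxA (Y t)) YX// mul1mx (mulmx1C (YX r rT)).
  by rewrite /v !mulmxN -!mulmxA (mulmxA (Phi r t)) PP mul1mx.
have zt : z t = y by rewrite /z It mul0mx subr0 (hPhi tT).1 mul1mx.
have zt1 : z t1 = 0 by rewrite /z It1 /eta mulmxA mulmxV// mul1mx subrr mulmx0.
pose g r := expR (kappa C * (r - t)).
have g2 r : g r ^+ 2 = expR (2 * kappa C * (r - t)).
  by rewrite -expRM_natl; congr expR; ring.
have g0 r : 0 <= g r by exact: expR_ge0.
have Phib r : t <= r <= t1 -> mxbound (Phi r t) (g r) /\ mxbound (Phi t r) (g r).
  by move=> /andP[h1 h2]; apply: evolution_growth; rewrite ?t0// (le_trans h2).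
have vle r : t <= r <= t1 -> enorm (v r) <= lamB C * (g r * enorm eta).
  move=> rI; rewrite /v enormN.
  apply: le_trans (mxbound_tr (ltW lB0) (B_bound (inT _ rI)) _) _.
  rewrite ler_wpM2l ?(ltW lB0)//.
  by apply: (mxbound_tr (g0 r)); case: (Phib r rI).
(* [alpha1'] is the integral of lamB^2 e^(2 kappa s) over [0, sigma]. *)
have Ile r : t <= r <= t1 -> enorm (I r *m eta) <= alpha1' C * enorm eta.
  move=> /andP[tr rt1].
  apply: enorm_dual; first by rewrite mulr_ge0 ?alpha1'_ge0 ?enorm_ge0.
  set f := I r *m eta.
  have hf := C1on_dot (C1on_cst t r f) (C1on_sub (lexx t) rt1 (C1on_mulmxr eta hI)).
  pose cst := lamB C ^+ 2 * enorm eta * enorm f / (2 * kappa C).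
  have hg := C1onZ cst (C1on_expR t r (2 * kappa C) t).
  have le s : t < s < r ->
      dot 0 (I s *m eta) + dot f (Phi t s *m mxB D s *m (mxB D s)^T *m (Phi t s)^T *m eta) <=
      cst * (2 * kappa C * expR (2 * kappa C * (s - t))).
    move=> /andP[ts sr]; have sI : t <= s <= t1 by rewrite ltW// (le_trans (ltW sr)).
    rewrite dot0l add0r (le_trans (cauchy_schwarz _ _))//.
    have -> : cst * (2 * kappa C * expR (2 * kappa C * (s - t))) =
        enorm f * (g s * (lamB C * (lamB C * (g s * enorm eta)))).
      by rewrite -g2 /cst; field; rewrite gt_eqF.
    rewrite ler_wpM2l ?enorm_ge0// -!mulmxA.
    apply: le_trans ((Phib s sI).2 _) _; rewrite ler_wpM2l//.
    apply: le_trans (B_bound (inT s sI) _) _; rewrite ler_wpM2l ?(ltW lB0)//.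
    by have := vle s sI; rewrite /v enormN.
  have := C1on_le tr hf hg le.
  rewrite It mul0mx dot0r subr0 subrr mulr0 expR0 mulr1 -/f => /le_trans; apply.
  have -> : alpha1' C * enorm eta * enorm f = cst * expR (2 * kappa C * sigma C) - cst.
    by rewrite /alpha1' /cst; field; rewrite gt_eqF.
  rewrite lerD2r ler_wpM2l//.
    by rewrite /cst; nneg.
  rewrite ler_expR ler_wpM2l ?mulr_ge0 ?(ltW k0)// lerBlDl.
  by rewrite (le_trans rt1).
have zle r : t <= r <= t1 -> enorm (z r) <= g r * ((1 + alpha1' C / alpha0' C) * enorm y).
  move=> rI; apply: le_trans ((Phib r rI).1 _) _; rewrite ler_wpM2l//.
  rewrite (le_trans (enormB _ _))// mulrDl mul1r lerD2l (le_trans (Ile r rI))//.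
  rewrite -mulrA ler_wpM2l ?alpha1'_ge0// (le_trans etale)// ler_wpM2r ?enorm_ge0//.
  apply: le_trans alpha0'_inv; rewrite ler_peMl ?invr_ge0 ?(ltW a0_gt0)//.
  by rewrite ler1n.
(* 1 / alpha0 is half of the bound 1 / alpha0', so squaring gains 1/4, which covers the factor 2. *)
have {}vle r : t <= r <= t1 -> 2 * dot (v r) (v r) <=
    g r ^+ 2 * (lamB C ^+ 2 / alpha0' C ^+ 2 * dot y y).
  move=> rI.
  have h1 : enorm (v r) <= lamB C * (g r * ((2^-1 / alpha0' C) * enorm y)).
    rewrite (le_trans (vle r rI))// ler_wpM2l ?(ltW lB0)// ler_wpM2l//.
    rewrite (le_trans etale)// ler_wpM2r ?enorm_ge0//.
    by rewrite ler_pdivlMl// alpha0'_inv.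
  have p0 : 0 <= lamB C * (g r * ((2^-1 / alpha0' C) * enorm y)).
    by rewrite (le_trans _ h1) ?enorm_ge0.
  rewrite enorm_le// in h1.
  have e : (lamB C * (g r * ((2^-1 / alpha0' C) * enorm y))) ^+ 2 =
      4^-1 * (g r ^+ 2 * (lamB C ^+ 2 / alpha0' C ^+ 2 * dot y y)).
    by rewrite -enorm_sqr; field; rewrite gt_eqF ?alpha0'_gt0.
  rewrite e in h1.
  have := dot_ge0 (v r); lra.
pose w := steering_weight * dot y y.
have w0 : 0 <= w by rewrite mulr_ge0 ?dot_ge0 ?steering_weight_ge0.
have hN := C1onZ (w / (2 * kappa C)) (C1on_expR t t1 (2 * kappa C) t).
have le r : t < r < t1 -> stage_cost D (z r) (v r) r <=
    w / (2 * kappa C) * (2 * kappa C * expR (2 * kappa C * (r - t))).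
  move=> /ltW2 rI; apply: le_trans (stage_cost_le _ _ (inT r rI)) _.
  rewrite mulrA mulfVK ?gt_eqF ?mulr_gt0// -g2.
  have h1 := zle r rI.
  have p0 := le_trans (enorm_ge0 _) h1.
  rewrite enorm_le// exprMn exprMn enorm_sqr in h1.
  set q := lamQ C + lamH C ^+ 2 / gamR C.
  have q0 : 0 <= q by rewrite addr_ge0 ?divr_ge0 ?exprn_ge0// ltW.
  have h2 : q * dot (z r) (z r) <= q * (g r ^+ 2 * ((1 + alpha1' C / alpha0' C) ^+ 2 * dot y y)).
    by rewrite ler_wpM2l.
  have h3 := vle r rI.
  have {}h3 : lamR C * (2 * dot (v r) (v r)) <=
      lamR C * (g r ^+ 2 * (lamB C ^+ 2 / alpha0' C ^+ 2 * dot y y)).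
    by rewrite ler_wpM2l// ltW.
  have -> : w * g r ^+ 2 =
      q * (g r ^+ 2 * ((1 + alpha1' C / alpha0' C) ^+ 2 * dot y y)) +
      lamR C * (g r ^+ 2 * (lamB C ^+ 2 / alpha0' C ^+ 2 * dot y y)).
    by rewrite /w /steering_weight -/q; ring.
  lra.
have := comparison a_ge0 bT at1 tt1 t1b hxl hz hN le.
rewrite zt zt1 dot0r mulr0 subr0 subrr mulr0 expR0 mulr1.
have V0 : 0 <= dot (x t1) (l t1) by apply: value_nonneg; rewrite (le_trans at1).
have wk : 0 <= w / (2 * kappa C) by nneg.
have Nb : w / (2 * kappa C) * expR (2 * kappa C * (t1 - t)) <= c1 C * dot y y.
  apply: (@le_trans _ _ (w / (2 * kappa C) * expR (2 * kappa C * sigma C))).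
    by rewrite ler_wpM2l// ler_expR ler_wpM2l ?mulr_ge0 ?(ltW k0)// lerBlDl.
  rewrite (_ : _ * _ = steering_weight / (2 * kappa C) * expR (2 * kappa C * sigma C) * dot y y).
    by rewrite ler_wpM2r ?dot_ge0 ?c1_ge_steering.
  by rewrite /w; ring.
lra.
Qed.

Lemma value_upper t y : a <= t <= b ->
  2 * dot (l t) y <= dot (x t) (l t) + c1 C * dot y y.
Proof.
move=> tab; have [h|/ltW h] := leP b (t + sigma C).
  exact: value_upper_short.
exact: value_upper_long.
Qed.

End ValueUpper.

(** Admissibility of c0 = mn w, with w = e^(-2 kappa sigma). The second entry of the minimum gives
    mn B <= 2 kappa, so the quadratic Riccati term is at most the linear one. The first gives 2
    kappa mn <= gamQ (1 - w)^2, so each term is at most gamQ (1 - w)^2 w <= gamQ / 2. *)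
Lemma c0_pos_le : [/\ 0 < c0 C, c0 C <= gamQ C &
  2 * kappa C * c0 C + c0 C ^+ 2 * (lamB C ^+ 2 / gamR C) <= gamQ C].
Proof.
rewrite /c0; set w := expR _.
have w0 : 0 < w by exact: expR_gt0.
have w1 : w < 1 by rewrite -expR0 ltr_expR oppr_lt0 !mulr_gt0.
have at0 : alpha0_tilde C = (1 - w) / (2 * kappa C) by [].
have at0_gt0 : 0 < alpha0_tilde C by rewrite at0 divr_gt0 ?subr_gt0 ?mulr_gt0.
have at1_ge0 : 0 <= alpha1_tilde C.
  have h : 0 <= expR (2 * kappa C * sigma C) - 1 by rewrite subr_ge0 expR_kappa_ge1.
  by rewrite /alpha1_tilde; nneg.
set B := lamB C ^+ 2 / gamR C.
have B0 : 0 <= B by rewrite /B; nneg.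
set X := B * _ + _; set Z := lamB C ^+ 2 / _ + _.
have Xge : (gamQ C * alpha0_tilde C ^+ 2)^-1 <= X.
  by rewrite /X div1r lerDr; nneg.
have iX0 : 0 < (gamQ C * alpha0_tilde C ^+ 2)^-1 by rewrite invr_gt0 mulr_gt0 ?exprn_gt0.
have X0 : 0 < X by exact: lt_le_trans Xge.
have B2k : B / (2 * kappa C) <= Z.
  rewrite /Z (_ : lamB C ^+ 2 / (2 * gamR C * kappa C) = B / (2 * kappa C)); last first.
    by rewrite /B; field; rewrite !gt_eqF.
  by rewrite lerDl div1r invr_ge0 ltW.
have Zge : (gamQ C)^-1 <= Z.
  by rewrite /Z div1r lerDr; nneg.
have Z0 : 0 < Z by apply: lt_le_trans Zge; rewrite invr_gt0.
set mn := Num.min _ _.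
have mnX : mn <= 2 * kappa C * X^-1 by rewrite /mn ge_min lexx.
have mnZ : mn <= Z^-1 by rewrite /mn ge_min lexx orbT.
have mn0 : 0 < mn by rewrite /mn lt_min invr_gt0 Z0 !mulr_gt0// invr_gt0.
have mnQ : mn <= gamQ C.
  by rewrite (le_trans mnZ)// -[leRHS]invrK lef_pV2 ?posrE ?invr_gt0.
have mnB : mn * B <= 2 * kappa C.
  have k2 : 0 < 2 * kappa C by rewrite mulr_gt0.
  rewrite -[leRHS]mul1r -ler_pdivrMr// -mulrA (le_trans (ler_wpM2l (ltW mn0) B2k))//.
  by rewrite -ler_pdivlMr// div1r.
have mnq : mn * (2 * kappa C) <= gamQ C * (1 - w) ^+ 2.
  have k2 : 0 < 2 * kappa C by rewrite mulr_gt0.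
  have iXle : X^-1 <= gamQ C * alpha0_tilde C ^+ 2.
    by rewrite -[leRHS]invrK lef_pV2 ?posrE.
  have h : mn <= 2 * kappa C * (gamQ C * alpha0_tilde C ^+ 2).
    by rewrite (le_trans mnX)// ler_wpM2l// ltW.
  have -> : gamQ C * (1 - w) ^+ 2 = 2 * kappa C * (gamQ C * alpha0_tilde C ^+ 2) * (2 * kappa C).
    by rewrite at0; field; rewrite gt_eqF.
  by rewrite ler_wpM2r// ltW.
split; first by rewrite mulr_gt0.
  by rewrite (le_trans _ mnQ)// ler_piMr// ltW.
have h1 : (mn * w) ^+ 2 * B <= mn * w * (2 * kappa C).
  rewrite expr2 -mulrA ler_wpM2l ?mulr_ge0 ?(ltW mn0) ?(ltW w0)//.
  have mnB0 : 0 <= mn * B by apply: mulr_ge0; [exact: ltW|].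
  by rewrite mulrAC (le_trans _ mnB)// ler_piMr// ltW.
have h2 : mn * (2 * kappa C) * w <= gamQ C * (1 - w) ^+ 2 * w.
  by rewrite ler_wpM2r// ltW.
have h3 : (1 - w) ^+ 2 * w <= 2^-1.
  have : 0 <= (w - 2^-1) ^+ 2 by rewrite sqr_ge0.
  have : 0 <= w * (w * (1 - w)) by rewrite !mulr_ge0 ?subr_ge0 ?ltW.
  by rewrite !expr2; lra.
have h4 : gamQ C * (1 - w) ^+ 2 * w <= gamQ C * 2^-1.
  by rewrite -mulrA ler_wpM2l// ltW.
lra.
Qed.

Lemma extremal_hamiltonian (a b : R) (x l : R -> 'cV[R]_nx) (u : R -> 'cV[R]_nu) :
  0 <= a -> b <= T ->
  C1on a b x (fun t => mxA D t *m x t + mxB D t *m u t) ->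
  C1on a b l (fun t => - ((mxA D t)^T *m l t) - mxQ D t *m x t - (mxH D t)^T *m u t) ->
  (forall t, a <= t <= b ->
     mxR D t *m u t + mxH D t *m x t + (mxB D t)^T *m l t = 0) ->
  hamiltonian a b reducedA reducedG reducedQ x l.
Proof.
move=> a0 bT hx hl stat.
have uE t : a < t < b ->
    (0 <= t <= T) *
    (u t = - (invmx (mxR D t) *m (mxH D t *m x t) + invmx (mxR D t) *m ((mxB D t)^T *m l t))).
  move=> /andP[h1 h2].
  have tT : 0 <= t <= T by rewrite (le_trans a0 (ltW h1)) (le_trans (ltW h2)).
  have [Ru _] := R_inv tT; split => //.
  have := stat t; rewrite !ltW// -addrA => /(_ isT)/eqP; rewrite addr_eq0 => /eqP e.
  by rewrite -mulmxDr -mulmxN -[- _]opprK -e !opprK mulmxA mulVmx// mul1mx.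
split.
  apply: C1on_eq hx => t /uE[tT ->].
  rewrite /reducedA /reducedG mulmxN mulmxBl mulmxDr !mulmxA opprD.
  by rewrite addrA.
apply: C1on_eq hl => t /uE[tT ->].
have e1 : (reducedA t)^T *m l t =
    (mxA D t)^T *m l t - (mxH D t)^T *m (invmx (mxR D t) *m ((mxB D t)^T *m l t)).
  by rewrite /reducedA linearB/= !trmx_mul Rinv_sym// mulmxBl -!mulmxA.
have e2 : reducedQ t *m x t =
    mxQ D t *m x t - (mxH D t)^T *m (invmx (mxR D t) *m (mxH D t *m x t)).
  by rewrite /reducedQ mulmxBl -!mulmxA.
rewrite e1 e2 mulmxN mulmxDr.
move: ((mxA D t)^T *m l t) (mxQ D t *m x t) (_ *m _) (_ *m _) => A1 A2 A3 A4.
by apply/matrixP => i j; rewrite !mxE; ring.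
Qed.

(** The global optimum restricted to [a, b] solves the same Hamiltonian system; it fails only the
    boundary conditions of the subproblem, by p - xs(a) on the left and by [d] on the right. *)
Lemma subdomain_error (a b : R) (p r : 'cV[R]_nx) (K : 'M[R]_nx)
    (xs ls xj lj : R -> 'cV[R]_nx) (us uj : R -> 'cV[R]_nu) :
  0 <= a -> a < b -> b <= T ->
  K^T = K -> (forall y, gamQ C * dot y y <= dot y (K *m y)) ->
  (forall y, dot y (K *m y) <= lamQ C * dot y y) ->
  hamiltonian 0 T reducedA reducedG reducedQ xs ls ->
  (forall t, 0 <= t <= T ->
     mxR D t *m us t + mxH D t *m xs t + (mxB D t)^T *m ls t = 0) ->
  optimal D a b p (quadratic K r) xj uj ->
  adjoint D a b xj uj (K *m xj b - r) lj ->
  let d := K *m xs b - ls b - r in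
  forall t, a <= t <= b ->
  [/\ enorm (xj t - xs t) <= cZ C * expR (- rhoZ C * (t - a)) * enorm (p - xs a)
        + lamB C ^+ 2 / gamR C * cZ C ^+ 2 / (2 * rhoZ C)
          * expR (- rhoZ C * (b - t)) * enorm d,
      enorm (lj t - ls t) <= c1 C * enorm (xj t - xs t)
        + cZ C * expR (- rhoZ C * (b - t)) * enorm d &
      enorm (uj t - us t) <= (lamH C * enorm (xj t - xs t)
        + lamB C * enorm (lj t - ls t)) / gamR C].
Proof.
move=> a0 ab bT symK Kge Kle hs stats optj adjj d t tab.
have [cA cB cQ cH cR] := data_continuous.
have [cF cG cQt] := reduced_continuous.
have inT s : a <= s <= b -> 0 <= s <= T.
  by move=> /andP[h1 h2]; rewrite (le_trans a0 h1) (le_trans h2).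
have statj : forall s, a <= s <= b ->
    mxR D s *m uj s + mxH D s *m xj s + (mxB D s)^T *m lj s = 0.
  apply: (optimal_stationary ab (within_sub a0 bT cA) (within_sub a0 bT cB)
    (within_sub a0 bT cQ) (within_sub a0 bT cH) (within_sub a0 bT cR) _ _ symK optj adjj).
    by move=> s /inT sT; case: hsym => ->.
  by move=> s /inT sT; case: hsym => _ ->.
have [[_ hxj xja] _] := optj; have [hlj ljb] := adjj.
have [hx hl] := extremal_hamiltonian a0 bT hxj hlj statj.
have hd : hamiltonian a b reducedA reducedG reducedQ
    (fun s => xj s - xs s) (fun s => lj s - ls s).
  have [hxs hls] := hs; split.
    apply: C1on_eq (C1onB hx (C1on_sub a0 bT hxs)) => s _.
    rewrite !mulmxBr.
    move: (_ *m xj s) (_ *m xs s) (_ *m lj s) (_ *m ls s) => A1 A2 A3 A4.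
    by apply/matrixP => i j; rewrite !mxE; ring.
  apply: C1on_eq (C1onB hl (C1on_sub a0 bT hls)) => s _.
  rewrite !mulmxBr.
  move: (_ *m lj s) (_ *m ls s) (_ *m xj s) (_ *m xs s) => A1 A2 A3 A4.
  by apply/matrixP => i j; rewrite !mxE; ring.
have db : lj b - ls b = K *m (xj b - xs b) + d.
  rewrite ljb /d mulmxBr.
  move: (K *m xj b) (K *m xs b) => A1 A2.
  by apply/matrixP => i j; rewrite !mxE; ring.
have [c0_gt0 c0_gQ c0_ric] := c0_pos_le.
have B0 : 0 <= lamB C ^+ 2 / gamR C by nneg.
have K0 y : 0 <= dot y (K *m y).
  by apply: le_trans (Kge y); rewrite mulr_ge0 ?dot_ge0// ltW.
have [ex el] := hamiltonian_decay (ltW ab) (within_sub a0 bT cF) (within_sub a0 bT cG)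
  (within_sub a0 bT cQt) (fun s h => reducedG_sym (inT s h)) (fun s h => reducedQ_sym (inT s h))
  symK (fun s h => reducedG_ge0 (inT s h)) (fun s h => reducedG_bound (inT s h))
  (fun s h => reducedQ_ge (inT s h)) (fun s h => reducedA_bound (inT s h)) Kge gQ0 B0
  c0_gt0 c1_gt0 c0_gQ c0_ric
  (fun x l hxl hb s h y => value_upper a0 bT hxl hb symK K0 Kle y h) hd db tab.
split => //; first by rewrite -xja.
have tT := inT t tab.
have [Ru Ri] := R_inv tT.
(* The difference of the two stationarity equations, solved for the control. *)
have -> : uj t - us t = - (invmx (mxR D t) *m (mxH D t *m (xj t - xs t)
    + (mxB D t)^T *m (lj t - ls t))).
  apply: (can_inj (mulKmx Ru)).
  rewrite mulmxN mulmxA mulmxV// mul1mx !mulmxBr.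
  have /eqP := statj t tab; rewrite -addrA addr_eq0 => /eqP ->.
  have /eqP := stats t tT; rewrite -addrA addr_eq0 => /eqP ->.
  move: (_ *m lj t) (_ *m ls t) (_ *m xj t) (_ *m xs t) => A1 A2 A3 A4.
  by apply/matrixP => i j; rewrite !mxE; ring.
rewrite enormN (le_trans (Ri _))// mulrC ler_wpM2r ?invr_ge0 ?(ltW gR0)//.
rewrite (le_trans (enormD _ _))// lerD ?H_bound//.
by apply: mxbound_tr; [exact: ltW|exact: B_bound].
Qed.
End Reduced.

(** * Schwarz iteration *)

Section Schwarz.
Context {R : realType}.

Lemma overlap_le m (tau0 tau1 : nat -> R) j : (1 <= j <= m)%N ->
  overlap m tau0 tau1 <= tau0 j.
Proof.
move=> /andP[j1 jm]; rewrite /overlap.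
apply: le_trans (le_bigmin_nat _ _ j1 (_ : (j.+1 <= m.+1)%N)) _ => //.
by rewrite big_ltn// big_geq// !ge_min lexx.
Qed.

Lemma decomposition_le T m (t tau0 tau1 : nat -> R) i j :
  decomposition T m t tau0 tau1 -> (i <= j <= m)%N -> t i <= t j.
Proof.
move=> [_ _ tS _] /andP[/subnK <-].
elim: (j - i)%N => [//|d IH]; rewrite addSn => dm.
by apply: le_trans (IH (ltnW dm)) _; apply: ltW; exact: tS.
Qed.

(** The index is the least one whose node lies beyond s. For s = T there is none, and the last part
    is closed on the right. *)
Lemma decomposition_cover T m (t tau0 tau1 : nat -> R) s :
  0 < T -> decomposition T m t tau0 tau1 -> 0 <= s <= T ->
  exists2 j, (1 <= j <= m)%N & kept_part m t j s.
Proof.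
move=> T0 hdec /andP[s0 sT]; have [t0 tm tS _] := hdec.
have m0 : (0 < m)%N by rewrite lt0n; apply/eqP => m0; move: T0; rewrite -tm m0 t0 ltxx.
have [[i /andP[im si]]|none] := pselect (exists i, (i <= m)%N && (s < t i)).
  have ex : exists i, (i <= m)%N && (s < t i) by exists i; rewrite im.
  case: (ex_minnP ex) => j /andP[jm sj] jmin.
  have j0 : (0 < j)%N by case: (j) sj => //; rewrite t0 ltNge s0.
  have tj : t j.-1 <= s.
    rewrite leNgt; apply/negP => h; have := jmin j.-1.
    by rewrite h (leq_trans (leq_pred _) jm) => /(_ isT); rewrite leqNgt ltn_predL j0.
  exists j; first by rewrite j0.
  by rewrite /kept_part; case: ifP => _; rewrite /= in_itv/= tj// ltW.
have Ts : T <= s by rewrite leNgt; apply/negP => h; apply: none; exists m; rewrite tm leqnn.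
exists m; first by rewrite m0 leqnn.
rewrite /kept_part ltnn /= in_itv/= tm sT andbT (le_trans _ Ts)// -tm.
by apply: (decomposition_le hdec); rewrite leq_pred leqnn.
Qed.

Lemma supnorm_le (V : Type) (N : V -> R) T (f : R -> V) (k : \bar R) :
  (supnorm N T f <= k)%E <-> forall s, 0 <= s <= T -> ((N (f s))%:E <= k)%E.
Proof.
split=> [h s sT|h].
  by apply: le_trans h; apply: ereal_sup_ubound; exists s.
by apply: ge_ereal_sup => _ [s sT <-]; apply: h; rewrite /= in_itv in sT.
Qed.

Section Error.
Context {nx nu : nat}.
Variables (T : R) (xs : R -> 'cV[R]_nx) (us : R -> 'cV[R]_nu) (ls : R -> 'cV[R]_nx).
Variables (x : R -> 'cV[R]_nx) (u : R -> 'cV[R]_nu) (l : R -> 'cV[R]_nx) (k : \bar R).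

Lemma error_le : (error T xs us ls x u l <= k)%E -> forall s, 0 <= s <= T ->
  [/\ ((enorm (x s - xs s))%:E <= k)%E, ((enorm (u s - us s))%:E <= k)%E &
      ((enorm (l s - ls s))%:E <= k)%E].
Proof.
rewrite /error !ge_max => /andP[/andP[/supnorm_le h1 /supnorm_le h2] /supnorm_le h3] s sT.
by split; [exact: h1|exact: h2|exact: h3].
Qed.

Lemma error_ge : (forall s, 0 <= s <= T ->
  [/\ ((enorm (x s - xs s))%:E <= k)%E, ((enorm (u s - us s))%:E <= k)%E &
      ((enorm (l s - ls s))%:E <= k)%E]) -> (error T xs us ls x u l <= k)%E.
Proof.
move=> h; rewrite /error !ge_max.
by apply/andP; split; [apply/andP; split|]; apply/supnorm_le => s /h[].
Qed.

End Error.

End Schwarz.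

(** A kept point has distance at least tau from every end that carries wrong data. Truncation at 0
    is harmless, as the iterates are exact there. Truncation at T for j < m is different: the data q
    still come from the previous iterate, and [hovl] keeps that end far enough. *)
Theorem theorem6 (R : realType) (nx nu : nat) (D : lq_data R nx nu)
  (C : lq_constants R) (T : R) (x0 : 'cV[R]_nx)
  (Phi : R -> R -> 'M[R]_nx)
  (hsym : symmetric_data D T)
  (hbnd : bounded_data D C T)
  (hPhi : evolution_operator (mxA D) T Phi)
  (hucc : uniformly_completely_controllable D C T Phi)
  (hcoe : coercive D C T)
  (* the optimal state, control and adjoint *)
  (xs : R -> 'cV[R]_nx) (us : R -> 'cV[R]_nu) (ls : R -> 'cV[R]_nx)
  (hopt : optimal D 0 T x0 (final_cost D) xs us)
  (hadj : adjoint D 0 T xs us (mxQT D *m xs T) ls)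
  (* the overlapping decomposition *)
  (m : nat) (t tau0 tau1 : nat -> R)
  (hdec : decomposition T m t tau0 tau1)
  (* tau does not exceed the actual right overlap of a non-final subdomain *)
  (hovl : forall j : nat, (1 <= j < m)%N ->
     overlap m tau0 tau1 <= right_end t tau1 T j - t j)
  (* the Schwarz iterates *)
  (x : nat -> R -> 'cV[R]_nx) (u : nat -> R -> 'cV[R]_nu)
  (l : nat -> R -> 'cV[R]_nx)
  (hit : schwarz_iterates D T x0 m t tau0 tau1 x u l)
  (k : nat) :
  (error T xs us ls (x k.+1) (u k.+1) (l k.+1)
   <= (3 * c_sigma C * expR (- rhoZ C * overlap m tau0 tau1))%:E
      * error T xs us ls (x k) (u k) (l k))%E.
Proof.
have gR0 : 0 < gamR C by case: hcoe.
have gQ0 : 0 < gamQ C by case: hcoe.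
have [lA0 lB0 lQ0 lH0 lR0] : [/\ 0 < lamA C, 0 < lamB C, 0 < lamQ C, 0 < lamH C & 0 < lamR C].
  by case: hbnd.
have T0 : 0 < T by case: hucc => /andP[h1 h2] _ _; exact: lt_trans h2.
have [c0_gt0 _ _] := c0_pos_le hbnd hucc hcoe.
have c1p := c1_gt0 hbnd hcoe.
have rho0 : 0 < rhoZ C by rewrite /rhoZ divr_gt0// mulr_gt0.
have cZ0 : 0 < cZ C by rewrite /cZ sqrtr_gt0 divr_gt0.
set tau := overlap m tau0 tau1.
pose Mx := Num.max (cZ C) (cZ C ^+ 2 * lamB C ^+ 2 * lamQ C / (2 * rhoZ C * gamR C)).
have Mx1 : cZ C <= Mx by rewrite le_max lexx.
have Mx2 : cZ C ^+ 2 * lamB C ^+ 2 * lamQ C / (2 * rhoZ C * gamR C) <= Mx.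
  by rewrite le_max lexx orbT.
have Mx0 : 0 < Mx by exact: lt_le_trans Mx1.
pose g := 1 + 1 / gamQ C.
have g1 : 1 <= g by rewrite /g lerDl divr_ge0// ltW.
pose P := 1 + lamH C / gamR C + (1 + lamB C / gamR C) * (c1 C + lamQ C).
have cE : c_sigma C = P * Mx * g by [].
have P0 : 0 < P.
  by rewrite /P addr_gt0 ?mulr_gt0 ?addr_gt0 ?divr_gt0.
pose e := expR (- rhoZ C * tau).
have e0 : 0 < e by exact: expR_gt0.
have const_gt0 : 0 < 3 * c_sigma C * e.
  by rewrite cE !mulr_gt0// (lt_le_trans _ g1).
have [t0 tm tS _] := hdec.
have m0 : (0 < m)%N by rewrite lt0n; apply/eqP => m0; move: T0; rewrite -tm m0 t0 ltxx.
have z0 : 0 <= (0 : R) <= T by rewrite lexx ltW.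
have TT : 0 <= T <= T by rewrite lexx ltW.
set err := error T xs us ls (x k) (u k) (l k).
have err_le : (error T xs us ls (x k) (u k) (l k) <= err)%E by [].
have err0 : (0 <= err)%E.
  have [h _ _] := error_le err_le z0.
  by apply: le_trans h; rewrite lee_fin enorm_ge0.
(* The initial guess is arbitrary, so its error may be infinite; the factor is positive and the
   right-hand side is then infinite too. *)
case E : err err0 => [w| |] // w0; last by rewrite gt0_muley ?lte_fin// leey.
rewrite lee_fin in w0.
rewrite E in err_le.
have err_w s : 0 <= s <= T -> [/\ enorm (x k s - xs s) <= w, enorm (u k s - us s) <= w
    & enorm (l k s - ls s) <= w].
  by move=> sT; have [] := error_le err_le sT; rewrite !lee_fin.
(* Subdomain 1 starts at 0 and keeps the point 0, so the initial value is inherited by every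
   iterate. *)
have xk0 i : x i 0 = x0.
  have [h0 hS] := hit; elim: i => [//|i IH].
  have m1 : (1 <= 1 <= m)%N by rewrite leqnn.
  have [xj [uj [lj [[[[_ _ xja] _] _] kp]]]] := hS i 1%N m1.
  have a0 : left_end t tau0 1 = 0.
    rewrite /left_end/= t0 sub0r; apply/max_idPr; rewrite oppr_le0.
    by have [_ _ _ /(_ 1%N m1)[/ltW]] := hdec.
  rewrite a0 in xja.
  have [-> _ _] : [/\ x i.+1 0 = xj 0, u i.+1 0 = uj 0 & l i.+1 0 = lj 0].
    apply: kp; rewrite /kept_part /=; case: ifP => _; rewrite /= in_itv/= t0 lexx/=.
      by rewrite -t0 tS.
    by rewrite -t0; apply: (decomposition_le hdec).
  by rewrite xja IH.
have xs0 : xs 0 = x0 by case: hopt => [[]].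
have [cA cB cQ cH cR] : [/\ {within `[0, T], continuous (mxA D)},
    {within `[0, T], continuous (mxB D)}, {within `[0, T], continuous (mxQ D)},
    {within `[0, T], continuous (mxH D)} & {within `[0, T], continuous (mxR D)}].
  by case: hbnd.
have [symQ symR symQT] := hsym.
have fcE : final_cost D = quadratic (mxQT D) 0.
  by apply/funext => y; rewrite /final_cost /quadratic dot0r subr0 -mulmxA.
have stats s : 0 <= s <= T ->
    mxR D s *m us s + mxH D s *m xs s + (mxB D s)^T *m ls s = 0.
  have hopt' : optimal D 0 T x0 (quadratic (mxQT D) 0) xs us by rewrite -fcE.
  have hadj' : adjoint D 0 T xs us (mxQT D *m xs T - 0) ls by rewrite subr0.
  exact: (optimal_stationary T0 cA cB cQ cH cR symQ symR symQT hopt' hadj').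
have hs : hamiltonian 0 T (reducedA D) (reducedG D) (reducedQ D) xs ls.
  case: hopt => [[_ hxs _] _]; case: hadj => hls _.
  exact: (extremal_hamiltonian hsym hcoe (lexx 0) (lexx T) hxs hls stats).
apply: error_ge => s sT.
have [j jm sj] := decomposition_cover T0 hdec sT.
have [_ /(_ k j jm)] := hit.
set a := left_end t tau0 j; set b := right_end t tau1 T j.
move=> [xj [uj [lj [[optj adjj] /(_ s sj)[-> -> ->]]]]].
have /andP[j1 jm'] := jm.
have [tau0j tau1j] : 0 < tau0 j /\ 0 < tau1 j by have [_ _ _ /(_ j jm)] := hdec.
have tj1 : t j.-1 < t j by rewrite -{2}(prednK j1); apply: tS; rewrite prednK.
have tjT : t j <= T by rewrite -tm; apply: (decomposition_le hdec); rewrite jm' leqnn.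
have tj0 : 0 <= t j.-1 by rewrite -t0; apply: (decomposition_le hdec); rewrite (leq_trans (leq_pred _)).
have /andP[s1 s2] : t j.-1 <= s <= t j.
  move: sj; rewrite /kept_part; case: ifP => _; rewrite /= in_itv//=.
  by move=> /andP[-> /ltW].
have a_ge0 : 0 <= a by rewrite /a /left_end le_max lexx orbT.
have a_le : a <= t j.-1 by rewrite /a /left_end ge_max tj0 gerBl ltW.
have b_ge : t j <= b by rewrite /b /right_end le_min tjT lerDl ltW.
have bT : b <= T by rewrite /b /right_end ge_min lexx orbT.
have ab : a < b by rewrite (le_lt_trans a_le)// (lt_le_trans tj1).
have sab : a <= s <= b by rewrite (le_trans a_le)// (le_trans s2).
have b01 : 0 <= b <= T by rewrite bT (le_trans a_ge0)// ltW.
have a01 : 0 <= a <= T by rewrite a_ge0 (le_trans (ltW ab)).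
(* Either a = 0, with no error, or s - a >= tau0 j >= tau. *)
have pe : expR (- rhoZ C * (s - a)) * enorm (x k a - xs a) <= e * w.
  have [an|an] := leP (t j.-1 - tau0 j) 0.
    have -> : a = 0 by rewrite /a /left_end; apply/max_idPr.
    by rewrite xk0 xs0 subrr enorm0 mulr0 mulr_ge0// ltW.
  have ea : a = t j.-1 - tau0 j by rewrite /a /left_end; apply/max_idPl/ltW.
  rewrite ler_pM ?expR_ge0 ?enorm_ge0//; last by case: (err_w a a01).
  rewrite ler_expR !mulNr lerN2 ler_wpM2l ?(ltW rho0)//.
  by rewrite (le_trans (overlap_le _ _ jm))// ea; lra.
pose K := if (j < m)%N then mxQ D b else mxQT D.
pose r := if (j < m)%N then mxQ D b *m (x k b - invmx (mxQ D b) *m l k b) else 0.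
have symK : K^T = K by rewrite /K; case: ifP => _ //; exact: symQ.
have Kge y : gamQ C * dot y y <= dot y (K *m y).
  rewrite /K; case: ifP => _; first exact: (Q_ge hcoe).
  by case: hcoe => _ _ _ /loewner_leP/(_ y) + _; rewrite dot_scalar_mx.
have Kle y : dot y (K *m y) <= lamQ C * dot y y.
  rewrite /K; case: ifP => _; first exact: dot_mxbound (Q_bound hbnd _).
  by case: hcoe => _ _ _ _ /loewner_leP/(_ y); rewrite dot_scalar_mx.
have LE : sub_final_cost D m j (mxQ D b) (x k b - invmx (mxQ D b) *m l k b) = quadratic K r.
  apply/funext => y; rewrite /sub_final_cost /K /r; case: ifP => _; last by rewrite fcE.
  by rewrite /quadratic /dot !mulmxA.
rewrite LE in optj adjj; rewrite (gradient_quadratic _ _ symK) in adjj.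
have := subdomain_error hsym hbnd hPhi hucc hcoe a_ge0 ab bT symK Kge Kle hs stats optj adjj sab.
set d := K *m xs b - ls b - r.
set X := enorm (xj s - xs s); set U := enorm (uj s - us s); set L := enorm (lj s - ls s).
(* For j < m, ls(b) is written as Q Q^-1 ls(b), so that [d] becomes Q applied to an iteration error.
   For j = m, [d] is 0 by the terminal condition of the global adjoint. *)
have de : expR (- rhoZ C * (b - s)) * enorm d <= lamQ C * g * (e * w).
  have rhs0 : 0 <= lamQ C * g * (e * w).
    by rewrite !mulr_ge0 ?(ltW lQ0) ?(ltW e0)// (le_trans ler01).
  rewrite /d /K /r; case: ifPn => jlt.
    have [Qu Qi] := Q_inv hcoe b01.
    have -> : mxQ D b *m xs b - ls b - mxQ D b *m (x k b - invmx (mxQ D b) *m l k b) =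
        - (mxQ D b *m ((x k b - xs b) - invmx (mxQ D b) *m (l k b - ls b))).
      rewrite !mulmxBr !mulmxA mulmxV// !mul1mx.
      move: (_ *m xs b) (_ *m x k b) => A1 A2.
      by apply/matrixP => i i'; rewrite !mxE; ring.
    have [ex _ el] := err_w b b01.
    have dle : enorm (- (mxQ D b *m ((x k b - xs b) - invmx (mxQ D b) *m (l k b - ls b)))) <=
        lamQ C * (g * w).
      rewrite enormN (le_trans (Q_bound hbnd b01 _))// ler_wpM2l ?(ltW lQ0)//.
      rewrite (le_trans (enormB _ _))// /g mulrDl mul1r div1r lerD//.
      by rewrite (le_trans (Qi _))// ler_wpM2l// invr_ge0 ltW.
    rewrite (_ : lamQ C * g * (e * w) = e * (lamQ C * (g * w))); last by ring.
    rewrite ler_pM ?expR_ge0 ?enorm_ge0//.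
    rewrite ler_expR !mulNr lerN2 ler_wpM2l ?(ltW rho0)//.
    by rewrite (le_trans (hovl j _)) ?j1// lerB.
  have bE : b = T.
    have je : j = m by apply/eqP; rewrite eqn_leq jm' leqNgt.
    by rewrite /b /right_end je tm; apply/min_idPr; rewrite lerDl -je ltW.
  have [_ lsT] := hadj.
  by rewrite bE lsT !subrr enorm0 mulr0.
have X0 : 0 <= X by exact: enorm_ge0.
have L0 : 0 <= L by exact: enorm_ge0.
move=> [hX hL hU].
(* The maximum [Mx] dominates the coefficients of both boundary errors, so each contributes at most
   [W] to the state error. *)
pose W := Mx * g * (e * w).
have W0 : 0 <= W by rewrite !mulr_ge0 ?(ltW Mx0) ?(ltW e0)// (le_trans ler01).
have {}hX : X <= 2 * W.
  apply: le_trans hX _.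
  have h1 : cZ C * expR (- rhoZ C * (s - a)) * enorm (x k a - xs a) <= W.
    rewrite -mulrA (le_trans (ler_wpM2l (ltW cZ0) pe))//.
    rewrite /W ler_wpM2r ?mulr_ge0 ?(ltW e0)//.
    by rewrite (le_trans Mx1)// ler_peMr// ltW.
  have h2 : lamB C ^+ 2 / gamR C * cZ C ^+ 2 / (2 * rhoZ C) *
      expR (- rhoZ C * (b - s)) * enorm d <= W.
    have B0 : 0 <= lamB C ^+ 2 / gamR C * cZ C ^+ 2 / (2 * rhoZ C) by nneg.
    rewrite -mulrA (le_trans (ler_wpM2l B0 de))// /W.
    rewrite [leLHS](_ : _ = cZ C ^+ 2 * lamB C ^+ 2 * lamQ C / (2 * rhoZ C * gamR C)
        * (g * (e * w))); last by field; rewrite !gt_eqF.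
    rewrite -[leRHS]mulrA ler_wpM2r// !mulr_ge0 ?(ltW e0)// (le_trans ler01)//.
  lra.
have {}hL : L <= (2 * c1 C + lamQ C) * W.
  apply: le_trans hL _.
  have h1 : c1 C * X <= c1 C * (2 * W) by rewrite ler_wpM2l// ltW.
  have h2 : cZ C * expR (- rhoZ C * (b - s)) * enorm d <= lamQ C * W.
    rewrite -mulrA (le_trans (ler_wpM2l (ltW cZ0) de))//.
    rewrite [leLHS](_ : _ = lamQ C * (cZ C * (g * (e * w)))); last by ring.
    rewrite ler_wpM2l ?(ltW lQ0)// /W -[leRHS]mulrA ler_wpM2r//.
    by rewrite !mulr_ge0 ?(ltW e0)// (le_trans ler01).
  lra.
have {}hU : U <= (2 * (lamH C / gamR C) + lamB C / gamR C * (2 * c1 C + lamQ C)) * W.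
  apply: le_trans hU _.
  have h1 : lamH C / gamR C * X <= lamH C / gamR C * (2 * W).
    by rewrite ler_wpM2l// divr_ge0// ltW.
  have h2 : lamB C / gamR C * L <= lamB C / gamR C * ((2 * c1 C + lamQ C) * W).
    by rewrite ler_wpM2l// divr_ge0// ltW.
  rewrite mulrDl (mulrAC (lamH C)) (mulrAC (lamB C)); lra.
(* The coefficients of [W] for state, control and adjoint are all sums of terms of [P] taken at most
   twice. *)
have final f : f <= 3 * P -> f * W <= 3 * c_sigma C * e * w.
  move=> fP; rewrite (_ : 3 * c_sigma C * e * w = 3 * P * W); last by rewrite cE /W; ring.
  by rewrite ler_wpM2r.
have rH : 0 < lamH C / gamR C by rewrite divr_gt0.
have rB : 0 < lamB C / gamR C by rewrite divr_gt0.
have rBc : 0 < lamB C / gamR C * c1 C by rewrite mulr_gt0.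
have rBQ : 0 < lamB C / gamR C * lamQ C by rewrite mulr_gt0.
rewrite -EFinM !lee_fin; split; (apply: le_trans; [eassumption|]); apply: final;
  rewrite /P; lra.
Qed.
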